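(* Let $\mathcal{D}$ be a regular ultrafilter on the infinite cardinal $\lambda$. The following are equivalent: (1) $\mathcal{D}$ is good. (2) Whenever $\mathcal{M}$ is a structure and $(\varphi,A)$ witnesses $\mathrm{SOP}_2$ in $\mathcal{M}$, every $(A)$-type of cardinality $\leq\lambda$ in $\widehat{\mathcal{M}}:=\mathcal{M}^\lambda/\mathcal{D}$ is realized in $\widehat{\mathcal{M}}$. (3) For every sequence of graphs $(\mathbb{G}_\alpha)_{\alpha<\lambda}$ such that neither $C_4$ nor $\ell_4$ is an induced subgraph of any $\mathbb{G}_\alpha$, the ultraproduct $\mathbb{G}:=\prod_{\alpha<\lambda}\mathbb{G}_\alpha/\mathcal{D}$ has the property that every $H\subseteq\mathbb{G}$ inducing a complete subgraph with $|H|=\lambda$ is contained in an internal subset of $\mathbb{G}$ inducing a complete subgraph. (4) Every graph-like function $f:\mathcal{P}_\omega(\lambda)\to\mathcal{D}$ satisfying \[f(\{x_0,x_1\})\cap f(\{x_1,x_2\})\cap f(\{x_2,x_3\})\subseteq f(\{x_0,x_2\})\cup f(\{x_1,x_3\})\] for all pairwise distinct $x_0,x_1,x_2,x_3\in\lambda$ has a multiplicative refinement.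
   Context: $\mathcal{P}_\omega(\lambda)$ is the set of finite subsets of $\lambda$, and $[X]^2$ the set of 2-element subsets of $X$. $\mathcal{D}$ is good if every monotone $f:\mathcal{P}_\omega(\lambda)\to\mathcal{D}$ (i.e. $\Delta\subseteq\Phi\Rightarrow f(\Phi)\subseteq f(\Delta)$) has a multiplicative refinement. A function $f:\mathcal{P}_\omega(\lambda)\to\mathcal{D}$ is graph-like if $f(\Delta)=\bigcap_{\Phi\in[\Delta]^2}f(\Phi)$ whenever $|\Delta|\geq 2$. A multiplicative refinement of $f$ is a function $g:\mathcal{P}_\omega(\lambda)\to\mathcal{D}$ with $g(\Delta)\subseteq f(\Delta)$ for all $\Delta$ and $g(\Delta\cup\Phi)=g(\Delta)\cap g(\Phi)$ for all $\Delta,\Phi$. An $\mathrm{SOP}_2$-tree in $\mathcal{M}$ is a formula $\varphi(\bar{x};\bar{y})$ together with tuples $(\bar{a}_\eta)_{\eta\in 2^{<\omega}}$ from $\mathcal{M}$ of the length of $\bar{y}$ such that for every $\Gamma\subseteq 2^{<\omega}$, the set $\{\varphi(\bar{x};\bar{a}_\eta):\eta\in\Gamma\}$ is consistent iff $\Gamma$ is a chain in the tree order of $2^{<\omega}$. $(\varphi,A)$ witnesses $\mathrm{SOP}_2$ in $\mathcal{M}$ if there is an $\mathrm{SOP}_2$-tree $(\varphi,(\bar{a}_\eta)_{\eta\in2^{<\omega}})$ in $\mathcal{M}$ with $A=\{\bar{a}_\eta:\eta\in 2^{<\omega}\}$. An $(A)$-type of $\mathcal{M}^\lambda/\mathcal{D}$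 is a type of the form $\{\varphi(\bar{x},\bar{a}_\beta):\beta<\kappa\}$ such that each parameter $\bar{a}_\beta$ has a representative $\bar{r}_\beta$ with $\bar{r}_\beta(\alpha)\in A$ for all $\alpha<\lambda$. $C_4$ is the 4-cycle and $\ell_4$ is the path on 4 vertices (3 edges). A graph $\mathbb{H}$ is an induced subgraph of $\mathbb{G}$ if there is an injective homomorphism $\mathbb{H}\to\mathbb{G}$ that also preserves non-edges. A subset of $\prod_\alpha\mathbb{G}_\alpha/\mathcal{D}$ is internal if it equals $\prod_\alpha K_\alpha/\mathcal{D}$ for some $K_\alpha\subseteq G_\alpha$. *)

(* Defs.v *)
From mathcomp Require Import all_boot finmap.
From mathcomp Require Import boolp classical_sets functions cardinality filter.

Set Implicit Arguments.
Unset Strict Implicit.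
Unset Printing Implicit Defensive.

Local Open Scope fset_scope.
Local Open Scope classical_set_scope.
Local Open Scope card_scope.
Local Open Scope quotient_scope.

(** * Ultrafilters on a cardinal, represented by a type [L] *)

(* [D] contains a family of |L| sets such that every point of [L] lies in
   only finitely many of them. *)
Definition regular (L : Type) (D : set_system L) : Prop :=
  exists E : set (set L),
    [/\ E `<=` D, E #= [set: L]
      & forall i : L, finite_set [set e | E e /\ e i]].

(* [{fset L}] plays the role of P_omega(L); a function into [D] is a function
   into [set L] all of whose values are members of [D]. *)
Section Refinements.
Variables (L : choiceType) (D : set_system L).
Implicit Types f g : {fset L} -> set L.

Definition into f : Prop := forall d, D (f d).

Definition monotone f : Prop := forall d e, (d `<=` e)%fset -> f e `<=` f d.

Definition multiplicative_refinement f g : Prop :=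
  [/\ into g, forall d, g d `<=` f d
    & forall d e, g (d `|` e)%fset = g d `&` g e].

Definition has_multiplicative_refinement f : Prop :=
  exists g, multiplicative_refinement f g.

Definition good : Prop :=
  forall f, into f -> monotone f -> has_multiplicative_refinement f.

Definition graph_like f : Prop :=
  forall d : {fset L}, (2 <= #|` d|)%N ->
    f d = \bigcap_(p in [set p : {fset L} | (p `<=` d)%fset /\ #|` p| = 2]) f p.

End Refinements.

(** * Ultraproducts *)

Section Ultraproduct.
Variables (L : Type) (D : set_system L) (FD : ProperFilter D).
Variable X : L -> Type.

(* The quotient library asks for a choice type. *)
Local Notation prodX := {classic forall i, X i}.

Definition ultra_rel (r s : prodX) : bool :=
  `[< D [set i | r i = s i] >].

Lemma ultra_rel_refl : reflexive ultra_rel.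
Proof. by move=> r; apply/asboolP; apply: filterE. Qed.

Lemma ultra_rel_sym : symmetric ultra_rel.
Proof.
by move=> r s; apply/asboolP/asboolP; apply: filterS => i /= ->.
Qed.

Lemma ultra_rel_trans : transitive ultra_rel.
Proof.
move=> s r t /asboolP rs /asboolP st; apply/asboolP.
by apply: filterS2 rs st => i /= -> ->.
Qed.

Canonical ultra_equiv : equiv_rel prodX :=
  EquivRel ultra_rel ultra_rel_refl ultra_rel_sym ultra_rel_trans.

Definition ultraproduct : Type := {eq_quot ultra_equiv}.

Definition ucls (r : forall i, X i) : ultraproduct := \pi_{eq_quot ultra_equiv} r.

Definition urep (x : ultraproduct) : forall i, X i :=
  repr (x : {eq_quot ultra_equiv}).

Definition internal (K : set ultraproduct) : Prop :=
  exists Kf : forall i, set (X i),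
    K = [set ucls r | r in [set r | forall i, Kf i (r i)]].

End Ultraproduct.

(** * First-order structures *)

Record language := Language {
  fsym : Type;
  farity : fsym -> nat;
  rsym : Type;
  rarity : rsym -> nat }.

Record structure (Lg : language) := Structure {
  carrier :> Type;
  fint : forall s : fsym Lg, ('I_(farity s) -> carrier) -> carrier;
  rint : forall s : rsym Lg, ('I_(rarity s) -> carrier) -> Prop }.

Section Formulas.
Variable Lg : language.

Inductive term (V : Type) : Type :=
| Var (v : V)
| App (s : fsym Lg) (ts : 'I_(farity s) -> term V).

(* [formula V] has its free variables in [V]; a quantifier binds the variable
   [None] of a formula over [option V]. *)
Inductive formula (V : Type) : Type :=
| Eq (t u : term V)
| Rel (s : rsym Lg) (ts : 'I_(rarity s) -> term V)
| Bot
| Imp (p q : formula V)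
| All (p : formula (option V)).

Variable M : structure Lg.

Fixpoint eval (V : Type) (e : V -> M) (t : term V) : M :=
  match t with
  | Var v => e v
  | App s ts => fint (fun i => eval e (ts i))
  end.

Fixpoint sat (V : Type) (e : V -> M) (p : formula V) : Prop :=
  match p with
  | Eq t u => eval e t = eval e u
  | Rel s ts => rint (fun i => eval e (ts i))
  | Bot => False
  | Imp p q => sat e p -> sat e q
  | All p => forall a : M, sat (fun v => if v is Some w then e w else a) p
  end.

End Formulas.

(* phi(x; y) with x of length [n] and y of length [m]. *)
Definition formula2 (Lg : language) (n m : nat) : Type :=
  formula Lg ('I_n + 'I_m).

Definition sat2 (Lg : language) (M : structure Lg) (n m : nat)
    (phi : formula2 Lg n m) (x : 'I_n -> M) (a : 'I_m -> M) : Prop :=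
  sat (fun v => match v with inl i => x i | inr j => a j end) phi.

(* A formula phi(x; a) with x of length [n] and parameters a from [M]. *)
Record pformula (Lg : language) (M : structure Lg) (n : nat) := PFormula {
  plength : nat;
  pbody : formula2 Lg n plength;
  pparam : 'I_plength -> M }.
Arguments PFormula {Lg M n plength}.
Arguments pparam {Lg M n} p k.

Section Types.
Variables (Lg : language) (M : structure Lg) (n : nat).
Implicit Types p q : set (pformula M n).

Definition satisfies (x : 'I_n -> M) p : Prop :=
  forall psi, p psi -> sat2 (pbody psi) x (pparam psi).

Definition realized p : Prop := exists x, satisfies x p.

(* Consistency with the elementary diagram of [M], that is, finite
   satisfiability in [M]. *)
Definition consistent p : Prop :=
  forall q, q `<=` p -> finite_set q -> realized q.

End Types.

Definition chain (G : set (seq bool)) : Prop :=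
  forall s t, G s -> G t -> prefix s t \/ prefix t s.

Definition SOP2_tree (Lg : language) (M : structure Lg) (n m : nat)
    (phi : formula2 Lg n m) (a : seq bool -> 'I_m -> M) : Prop :=
  forall G : set (seq bool),
    consistent [set PFormula phi (a s) | s in G] <-> chain G.

Definition witnesses_SOP2 (Lg : language) (M : structure Lg) (n m : nat)
    (phi : formula2 Lg n m) (A : set ('I_m -> M)) : Prop :=
  exists a : seq bool -> 'I_m -> M, SOP2_tree phi a /\ A = range a.

Section Ultrapower.
Variables (L : Type) (D : set_system L) (FD : ProperFilter D).
Variables (Lg : language) (M : structure Lg).

Definition ultrapower : structure Lg :=
  @Structure Lg (ultraproduct FD (fun _ => M))
    (fun s x => ucls FD (fun i => fint (fun k => urep (x k) i)))
    (fun s x => D [set i | rint (fun k => urep (x k) i)]).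

(* [r] represents the tuple [b] coordinatewise. *)
Definition tuple_representative (m : nat) (b : 'I_m -> ultrapower)
    (r : L -> 'I_m -> M) : Prop :=
  forall k, b k = ucls FD (fun i => r i k).

Definition A_type (n m : nat) (phi : formula2 Lg n m) (A : set ('I_m -> M))
    (p : set (pformula ultrapower n)) : Prop :=
  consistent p /\
  exists B : set ('I_m -> ultrapower),
    p = [set PFormula phi b | b in B] /\
    forall b, B b ->
      exists r, tuple_representative b r /\ forall i, A (r i).

End Ultrapower.

(** * Graphs *)

Record graph := Graph {
  vertex :> Type;
  adj : vertex -> vertex -> Prop;
  adj_sym : forall x y, adj x y -> adj y x;
  adj_irrefl : forall x, ~ adj x x }.

Definition induced_subgraph (H G : graph) : Prop :=
  exists h : H -> G,
    [/\ injective h, forall x y, adj x y -> adj (h x) (h y)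
      & forall x y, ~ adj x y -> ~ adj (h x) (h y)].

Definition complete (G : graph) (K : set G) : Prop :=
  forall x y, K x -> K y -> x <> y -> adj x y.

Definition C4_adj (i j : 'I_4) : Prop := j = ordS i \/ i = ordS j.

Lemma C4_adj_sym i j : C4_adj i j -> C4_adj j i.
Proof. by case; [right|left]. Qed.

Lemma C4_adj_irrefl i : ~ C4_adj i i.
Proof. by case: i => [[|[|[|[|]]]] Hi] // [] /(congr1 val). Qed.

Definition C4 : graph := Graph C4_adj_sym C4_adj_irrefl.

Definition l4_adj (i j : 'I_4) : Prop := j = i.+1 :> nat \/ i = j.+1 :> nat.

Lemma l4_adj_sym i j : l4_adj i j -> l4_adj j i.
Proof. by case; [right|left]. Qed.

Lemma l4_adj_irrefl i : ~ l4_adj i i.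
Proof. by case=> /eqP; rewrite ltn_eqF. Qed.

Definition l4 : graph := Graph l4_adj_sym l4_adj_irrefl.

Section GraphUltraproduct.
Variables (L : Type) (D : set_system L) (FD : ProperFilter D).
Variable G : L -> graph.

Definition ugraph_adj (x y : ultraproduct FD (fun i => G i)) : Prop :=
  D [set i | adj (urep x i) (urep y i)].

Lemma ugraph_adj_sym x y : ugraph_adj x y -> ugraph_adj y x.
Proof. by apply: filterS => i /= /adj_sym. Qed.

Lemma ugraph_adj_irrefl x : ~ ugraph_adj x x.
Proof. by move=> /filter_ex [i /= /adj_irrefl]. Qed.

Definition graph_ultraproduct : graph :=
  Graph ugraph_adj_sym ugraph_adj_irrefl.

End GraphUltraproduct.

(* Main.v *)
(** Goodness amounts to saturation for internal sets: every [L]-indexed family of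
    internal conditions that is finitely satisfiable is satisfiable.  With Los's
    theorem this gives (2).  For (3), in a graph without induced [C4] and [l4] the
    closed neighbourhoods of adjacent vertices are nested, so a finite part of it
    embeds into the comparability graph of 2^{<omega}; by regularity, a complete
    set then becomes a type over an SOP_2-tree.  (4) is the case of (3) where [G i]
    joins [a] and [b] iff [i] is in [f {a, b}].

    For (4) => (1), following Malliaris and Shelah: comparability in a forest
    satisfies the condition of (4), so chains of length at most [|L|] in
    ultraproducts of forests are bounded.  Let [K] be the least initial segment of a
    well-order of [L] for which saturation fails.  Bounding chains of finite
    sequences produces an internal sequence whose terms satisfy more and more of the
    conditions, and the failure of saturation turns it into an unfilled gap in the
    ultrapower of omega with lower half indexed by [K].  Index the upper half
    [d] by the least possible initial segment [T] of [K].  If [T = K], a chain of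
    nested intervals fills the gap.  Otherwise let [W] be an initial segment of [K] of
    the order type of the successor cardinal of [T] and colour a pair [z < w] in [W]
    by [d (j w z)], where [j w] injects the predecessors of [w] into [T].  An internal
    sequence of subsets of [W] on which the colours exceed more and more of the lower
    half splits [W] into [T] many classes; on each class the colours stay above
    some point of the upper half, so [j w] is bounded in [T] there and the class has
    cardinality at most [|T|], whence [|W| <= |T| * |T| = |T|]. *)

Require Import Defs.
From mathcomp Require Import all_boot finmap.
From mathcomp Require Import boolp classical_sets functions cardinality filter.
From mathcomp Require wochoice.
From mathcomp Require Import generic_quotient.

Local Open Scope fset_scope.
Local Open Scope classical_set_scope.
Local Open Scope card_scope.

Set Implicit Arguments.
Unset Strict Implicit.
Unset Printing Implicit Defensive.

(** * Well-orders and cardinals *)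

Definition well_order_lt {T : Type} (lt : T -> T -> Prop) : Prop :=
  [/\ forall x y z, lt x y -> lt y z -> lt x z,
      forall x y, lt x y \/ x = y \/ lt y x & well_founded lt].

Lemma exists_well_order_lt (T : eqType) : exists lt : T -> T -> Prop, well_order_lt lt.
Proof.
have [R woR] := @wochoice.well_ordering_principle T.
have woA : wochoice.wo_chain R predT by move=> A _ /woR.
have Rtot x y : R x y \/ R y x by apply/orP; exact: (wochoice.wo_chainW woA).
have Ranti x y : R x y -> R y x -> x = y.
  by move=> xy yx; apply: (wochoice.wo_chain_antisymmetric woA) => //; rewrite xy yx.
have Rmin (A : set T) a : A a -> exists2 z, A z & forall x, A x -> R z x.
  move=> Aa; have [|z [[zA zmin] _]] := woR [pred x | `[< A x >]].
    by exists a; apply/asboolP.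
  exists z; first by move/asboolP: zA.
  by move=> x Ax; apply: zmin; apply/asboolP.
have Rtr x y z : R x y -> R y z -> R x z.
  move=> xy yz; have [w Aw wmin] := Rmin [set u | [\/ u = x, u = y | u = z]] x (Or31 _ _ erefl).
  have wx := wmin x (Or31 _ _ erefl); have wy := wmin y (Or32 _ _ erefl).
  have wz := wmin z (Or33 _ _ erefl).
  case: Aw => wE; subst w => //.
    by rewrite (Ranti _ _ xy wx).
  by rewrite -(Ranti _ _ yz wy).
exists (fun x y => R x y /\ x <> y); split.
- move=> x y z [xy nxy] [yz nyz]; split; first exact: Rtr yz.
  by move=> xz; subst z; apply: nxy; exact: Ranti.
- move=> x y; have [->|/eqP nxy] := eqVneq x y; first by right; left.
  by have [xy|yx] := Rtot x y; [left|right; right; split => // yx'; apply: nxy].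
- move=> x; apply: contrapT => nAx.
  have [z nAz zmin] := Rmin [set u | ~ Acc (fun x y => R x y /\ x <> y) u] x nAx.
  apply: nAz; constructor => y [yz nyz]; apply: contrapT => /zmin zy.
  by apply: nyz; exact: Ranti.
Qed.

Lemma wf_min {T : Type} {lt : T -> T -> Prop} (wf : well_founded lt) (A : set T) a :
  A a -> exists2 x, A x & forall y, lt y x -> ~ A y.
Proof.
elim/(well_founded_ind wf): a => a IH Aa.
have [[y ya Ay]|noy] := pselect (exists2 y, lt y a & A y); first exact: IH Ay.
by exists a => // y ya Ay; apply: noy; exists y.
Qed.

(** Recursion along [lt] with a choice at each stage. Solvability is asked only of the finished [f],
    so it can be proved afterwards, by induction. *)
Lemma wf_choice {T Z : Type} {lt : T -> T -> Prop} (wf : well_founded lt) (z0 : Z)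
    (Phi : T -> (T -> Z) -> Z -> Prop) :
  (forall a f g z, (forall b, lt b a -> f b = g b) -> Phi a f z -> Phi a g z) ->
  exists f : T -> Z, forall a, (exists z, Phi a f z) -> Phi a f (f a).
Proof.
move=> Phi_ext.
pose ext a (h : forall b, lt b a -> Z) b : Z :=
  if pselect (lt b a) is left ba then h b ba else z0.
pose step a (h : forall b, lt b a -> Z) : Z := xget (z0 : {classic Z}) [set z | Phi a (ext a h) z].
pose f := Fix wf (fun _ => Z) step.
have fE a : f a = step a (fun b _ => f b).
  rewrite /f Fix_eq // => x h h' hh'; congr step.
  by apply: functional_extensionality_dep => y; apply: functional_extensionality_dep.
exists f => a [z Pz].
have fab b : lt b a -> f b = ext a (fun b _ => f b) b.
  by move=> ba; rewrite /ext; case: pselect.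
have : [set z | Phi a (ext a (fun b _ => f b)) z] (f a).
  by rewrite fE; apply: (@xgetPex {classic Z}); exists z; exact: Phi_ext Pz.
by apply: Phi_ext => b /fab.
Qed.

Lemma card_le_injP {T U : Type} (u0 : U) {A : set T} {B : set U} :
  A #<= B <-> exists2 f : T -> U, set_fun A B f & set_inj A f.
Proof.
elim/Ppointed: U => U in u0 B *; first by case: (no u0).
by rewrite -injfunPex; split=> /pcard_leP.
Qed.

(** Hilbert's hotel along a copy of [nat] inside [A] without [m]: [m] moves to [f 0] and [f n] to
    [f n.+1]. *)
Lemma infinite_card_le_setD1 {T : Type} (A : set T) (m : T) :
  infinite_set A -> A #<= A `\ m.
Proof.
move=> Ainf; have /infiniteP/(card_le_injP m)[f fA finj] : infinite_set (A `\ m).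
  exact: infinite_setD (finite_set1 m).
pose shift x := if pselect (exists n, x = f n) is left e then f (projT1 (cid e)).+1
  else if pselect (x = m) then f 0%N else x.
have shiftf n : shift (f n) = f n.+1.
  rewrite /shift; case: pselect => [e|[]]; last by exists n.
  by case: (cid e) => k /= fkn; congr (f _.+1); apply/esym/finj; rewrite ?inE.
have fm n : f n <> m by case: (fA n I).
have shiftm : shift m = f 0%N.
  by rewrite /shift; case: pselect => [[n /esym/fm]|_] //; case: pselect.
have shiftE x : ~ (exists n, x = f n) -> x <> m -> shift x = x.
  by rewrite /shift => nf nm; case: pselect => // _; case: pselect.
have cases x : [\/ exists n, x = f n, x = m | ~ (exists n, x = f n) /\ x <> m].
  have [|nf] := pselect (exists n, x = f n); first by constructor 1.
  by have [->|] := pselect (x = m); [constructor 2|constructor 3].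
apply/(card_le_injP m); exists shift.
  move=> x Ax; case: (cases x) => [[n ->]|->|[nf nm]].
  - by rewrite shiftf; exact: fA.
  - by rewrite shiftm; exact: fA.
  - by rewrite shiftE.
move=> x y _ _; case: (cases x) => [[n ->]|->|[nf nm]];
  case: (cases y) => [[k ->]|->|[nf' nm']]; rewrite ?shiftf ?shiftm ?(shiftE x) ?(shiftE y) //.
- by move=> /finj; rewrite !inE => /(_ I I) [->].
- by move=> /finj; rewrite !inE => /(_ I I).
- by move=> e; case: nf'; exists n.+1.
- by move=> /finj; rewrite !inE => /(_ I I).
- by move=> e; case: nf'; exists 0%N.
- by move=> e; case: nf; exists k.+1.
- by move=> e; case: nf; exists 0%N.
Qed.

(* Greedy recursion: each [p] takes a point of [A] that no predecessor has taken. *)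
Lemma card_le_of_initial_segments {P U : Type} {lt : P -> P -> Prop}
    (wo : well_order_lt lt) (Q : set P) (A : set U) :
  (forall p, Q p -> ~ (A #<= [set q | Q q /\ lt q p])) -> Q #<= A.
Proof.
move: wo => [_ tot wf] small.
have [->|/set0P[p0 Qp0]] := eqVneq Q set0; first exact: card_ge0.
have [a0 Aa0] : A !=set0.
  apply: contrapT => A0; apply: (small p0 Qp0).
  by rewrite (_ : A = set0) ?card_ge0 //; apply/eqP/negP => /negP/set0P.
have [f fP] := @wf_choice _ _ _ wf a0 (fun p f z => A z /\ forall q, Q q -> lt q p -> f q <> z)
  (fun p f g z fg fz => conj fz.1 (fun q Qq qp e => fz.2 q Qq qp (etrans (fg q qp) e))).
have fQ p : Q p -> A (f p) /\ forall q, Q q -> lt q p -> f q <> f p.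
  move=> Qp; apply: fP; apply: contrapT => noz; apply: (small p Qp).
  apply: card_le_trans (card_image_le f _); apply: subset_card_le => z Az.
  apply: contrapT => nz; apply: noz; exists z; split => // q Qq qp fqz.
  by apply: nz; exists q.
apply/(card_le_injP a0); exists f => [p /fQ[]//|p q /set_mem Qp /set_mem Qq fpq].
have [pq|[//|qp]] := tot p q.
  by have [_ /(_ p Qp pq)] := fQ q Qq.
by have [_ /(_ q Qq qp)] := fQ p Qp; rewrite fpq.
Qed.

Definition lex {T1 T2 : Type} (lt1 : T1 -> T1 -> Prop) (lt2 : T2 -> T2 -> Prop)
  (p q : T1 * T2) : Prop := lt1 p.1 q.1 \/ p.1 = q.1 /\ lt2 p.2 q.2.

Lemma well_order_lex {T1 T2 : Type} {lt1 : T1 -> T1 -> Prop} {lt2 : T2 -> T2 -> Prop} :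
  well_order_lt lt1 -> well_order_lt lt2 -> well_order_lt (lex lt1 lt2).
Proof.
move=> [tr1 tot1 wf1] [tr2 tot2 wf2]; split.
- move=> [x x'] [y y'] [z z'] [/= xy|[/= -> xy]] [/= yz|[/= <- yz]].
  + by left; exact: tr1 yz.
  + by left.
  + by left.
  + by right; split => //; exact: tr2 yz.
- move=> [x x'] [y y']; have [xy|[<-|yx]] := tot1 x y; first by left; left.
    by have [xy|[<-|yx]] := tot2 x' y'; [left; right|right; left|right; right; right].
  by right; right; left.
- move=> [x x']; elim/(well_founded_ind wf1): x x' => x IH1.
  elim/(well_founded_ind wf2) => x' IH2; constructor => -[y y'] [/= /IH1//|[/= ->]].
  exact: IH2.
Qed.

Lemma well_order_comp {T U : Type} {lt : T -> T -> Prop} (f : U -> T) :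
  injective f -> well_order_lt lt -> well_order_lt (fun x y => lt (f x) (f y)).
Proof.
move=> finj [tr tot wf]; split.
- by move=> x y z; exact: tr.
- by move=> x y; have [|[/finj|]] := tot (f x) (f y); [left|right; left|right; right].
- suff acc y : Acc lt y -> forall x, f x = y -> Acc (fun x y => lt (f x) (f y)) x.
    by move=> x; exact: acc (wf (f x)) x erefl.
  elim=> {}y _ IH x xy; constructor => z zx; apply: IH erefl.
  by rewrite -xy.
Qed.

(** * The square of an infinite initial segment *)

Section Hessenberg.
Context {T : Type} {lt : T -> T -> Prop}.
Hypothesis wo : well_order_lt lt.
Local Notation below x := [set y | lt y x].

Let maxlt x y := if pselect (lt x y) then y else x.

(* The maximum comes first, so that the predecessors of a pair lie in the square of a
   proper initial segment. *)
Let lt_pair (p q : T * T) :=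
  lex lt (lex lt lt) (maxlt p.1 p.2, p) (maxlt q.1 q.2, q).

(** If a smaller segment has as many points, induction applies to it. Otherwise the predecessors of
    a pair lie in the square of some [below m] with [lt m x], which is finite or, by induction, no
    larger than [below m]. *)
Lemma hessenberg x : infinite_set (below x) -> below x `*` below x #<= below x.
Proof.
have [ltr tot wf] := wo.
elim/(well_founded_ind wf): x => x IH xinf.
have [[y yx xy]|xmin] := pselect (exists2 y, lt y x & below x #<= below y).
  have yinf : infinite_set (below y) by apply: contra_not xinf => /card_le_finite; apply.
  have xyP : below x `*` below x #<= below y `*` below y.
    move: xy => /(card_le_injP x)[f fxy finj].
    apply/(card_le_injP (x, x)); exists (fun p => (f p.1, f p.2)).
      by move=> p [p1 p2]; split; exact: fxy.
    move=> [a b] [c d] /set_mem[/= xa xb] /set_mem[/= xc xd] [ac bd].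
    by congr (_, _); apply: finj; rewrite ?inE.
  apply: (card_le_trans xyP); apply: (card_le_trans (IH y yx yinf)).
  by apply: subset_card_le => z zy; exact: ltr yx.
(* Removing a maximum would not lower the cardinality, so [below x] has none. *)
have nomax m : lt m x -> exists2 m', lt m' x & lt m m'.
  move=> mx; apply: contrapT => nom; apply: xmin; exists m => //.
  apply: card_le_trans (infinite_card_le_setD1 m xinf) _.
  apply: subset_card_le => z [/= zx zm]; have [//|[//|mz]] := tot z m.
  by case: nom; exists z.
have wop : well_order_lt lt_pair.
  apply: (@well_order_comp _ _ _ (fun p : T * T => (maxlt p.1 p.2, p))).
    by move=> p q [].
  exact/well_order_lex/well_order_lex.
apply: (card_le_of_initial_segments wop) => -[a b] [/= ax bx] small.
have max_x : lt (maxlt a b) x by rewrite /maxlt; case: pselect.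
have [m mx maxm] := nomax _ max_x.
have {small} xm : below x #<= below m `*` below m.
  apply: card_le_trans small _; apply: subset_card_le => -[c d] [_ cd].
  have max_m : lt (maxlt c d) m.
    by case: cd => [/= cd|[/= -> _]//]; exact: ltr maxm.
  move: max_m; rewrite /maxlt; case: pselect => [cd' dm|ncd cm]; split => //=.
    exact: ltr dm.
  by have [//|[<-//|dc]] := tot c d; exact: ltr cm.
apply: xmin; exists m => //; have [mfin|minf] := pselect (finite_set (below m)).
  by case: xinf; apply: card_le_finite xm _; exact: finite_setX.
exact: card_le_trans xm (IH m mx minf).
Qed.

End Hessenberg.

(** * Saturation of ultraproducts *)

Lemma seq_max {I : eqType} (r : I -> I -> Prop) (s : seq I) (a : I) :
  (forall x y z, r x y -> r y z -> r x z) ->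
  (forall x y, x \in s -> y \in s -> r x y \/ r y x) -> a \in s ->
  exists2 c, c \in s & forall b, b \in s -> r b c.
Proof.
move=> tr; elim: s a => // x s IH a tot _; have [s0|s0] := eqVneq s [::].
  exists x; first exact: mem_head.
  by move=> b; rewrite s0 inE => /eqP ->; case: (tot x x) => //; exact: mem_head.
have [a' a's] : exists a', a' \in s by case: s s0 {IH tot} => // y s _; exists y; exact: mem_head.
have [|c cs cmax] := IH a' _ a's.
  by move=> y z ys zs; apply: tot; rewrite inE ?ys ?zs orbT.
have [xc|cx] : r x c \/ r c x by apply: tot; rewrite inE ?eqxx ?cs ?orbT.
  by exists c; [rewrite inE cs orbT|move=> b; rewrite inE => /predU1P[->|/cmax]].
exists x; first exact: mem_head.
move=> b; rewrite inE => /predU1P[->|/cmax bc]; last exact: tr cx.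
by case: (tot x x) => //; exact: mem_head.
Qed.

(** Taken in each coordinate, this gives overspill: the greatest member of an internal set of
    naturals up to a bound. The default [0] counts only when there is no such member. *)
Definition max_below (Q : set nat) (N : nat) : nat :=
  xget 0%N [set k | [/\ Q k, (k <= N)%N & forall j, Q j -> (j <= N)%N -> (j <= k)%N]].

Lemma max_belowP (Q : set nat) N k : Q k -> (k <= N)%N ->
  [/\ Q (max_below Q N), (max_below Q N <= N)%N
    & forall j, Q j -> (j <= N)%N -> (j <= max_below Q N)%N].
Proof.
move=> Qk kN; apply: (@xgetPex _ 0%N [set k | [/\ Q k, (k <= N)%N &
  forall j, Q j -> (j <= N)%N -> (j <= k)%N]]).
pose p j := `[< Q j >] && (j <= N)%N.
have [||m /andP[/asboolP Qm mN] mmax] := @ex_maxnP p N.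
- by exists k; rewrite /p kN andbT; apply/asboolP.
- by move=> j /andP[].
by exists m; split=> // j Qj jN; apply: mmax; rewrite /p jN andbT; apply/asboolP.
Qed.

Section Saturation.
Variables (L : choiceType) (D : set_system L).

(* [X i] and [P b i] are the coordinates at [i] of an internal set and of its [b]-th
   internal subset. *)
Definition saturated (A : set L) : Prop :=
  forall (X : L -> Type) (x0 : forall i, X i) (P : L -> forall i, X i -> Prop),
    (forall F : {fset L}, [set` F] `<=` A ->
       D [set i | exists x, forall b, b \in F -> P b i x]) ->
    exists x : forall i, X i, forall b, A b -> D [set i | P b i (x i)].

(* The treetops property of Malliaris and Shelah, for chains indexed by subsets of [L]. *)
Definition treetops : Prop :=
  forall (Z : L -> Type) (le : forall i, Z i -> Z i -> Prop),
    (forall i x, le i x x) ->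
    (forall i x y z, le i x y -> le i y z -> le i x z) ->
    (forall i x y z, le i x z -> le i y z -> le i x y \/ le i y x) ->
    forall (A : set L) (s : L -> forall i, Z i), A !=set0 ->
      (forall a b, A a -> A b -> D [set i | le i (s a i) (s b i) \/ le i (s b i) (s a i)]) ->
      exists t : forall i, Z i, forall a, A a -> D [set i | le i (s a i) (t i)].

Context {UD : UltraFilter D}.

Lemma filter_fset (F : {fset L}) (Q : L -> set L) :
  (forall b, b \in F -> D (Q b)) -> D [set i | forall b, b \in F -> Q b i].
Proof. by move=> DQ; apply: filterS (filter_bigI _ DQ) => i Qi b /Qi. Qed.

Lemma filter_choice (X : L -> Type) (x0 : forall i, X i) (Q : forall i, X i -> Prop) :
  D [set i | exists x, Q i x] -> exists x : forall i, X i, D [set i | Q i (x i)].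
Proof.
move=> DQ; exists (fun i => xget (x0 i : {classic X i}) [set x | Q i x]).
by apply: filterS DQ => i; exact: (@xgetPex {classic X i}).
Qed.

Lemma saturated_card_le (A B : set L) : A #<= B -> saturated B -> saturated A.
Proof.
have [->|/set0P[a0 _]] := eqVneq A set0.
  by move=> _ _ X x0 P _; exists x0.
move=> /(card_le_injP a0)[f fAB finj] satB X x0 P Pfin.
(* The condition at [c] is the one at its preimage under [f], and vacuous if there is none. *)
have [|x xP] := satB X x0 (fun c i x => forall b, A b -> f b = c -> P b i x).
  move=> F _; pose g c := xget a0 [set b | A b /\ f b = c].
  pose G := [fset g c | c in F & `[< exists b, A b /\ f b = c >]]%fset.
  have gP c : (exists b, A b /\ f b = c) -> A (g c) /\ f (g c) = c by exact: xgetPex.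
  have GA : [set` G] `<=` A.
    by move=> b /imfsetP[c]; rewrite !inE => /andP[_ /asboolP/gP[Agc _]] ->.
  apply: filterS (Pfin G GA) => i [x xP]; exists x => c cF b Ab fbc; apply: xP.
  have /gP[Agc fgc] : exists b, A b /\ f b = c by exists b.
  apply/imfsetP; exists c; first by rewrite !inE cF; apply/asboolP; exists b.
  by apply: finj; rewrite ?inE// fgc.
exists x => b Ab; apply: filterS (xP (f b) (fAB _ Ab)) => i; exact.
Qed.

(** The condition at [a] is added to each of the others; when [A] is empty there is none to carry
    it, hence the separate case. *)
Lemma saturatedU1 (A : set L) (a : L) : saturated A -> saturated (a |` A).
Proof.
move=> satA X x0 P Pfin; have [A0|/set0P[b0 Ab0]] := eqVneq A set0.
  have [|x xP] := @filter_choice X x0 (P a).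
    have aA : [set` [fset a]%fset] `<=` a |` A.
      by move=> b /=; rewrite inE => /eqP ->; left.
    by apply: filterS (Pfin _ aA) => i [x xP]; exists x; apply: xP; rewrite inE.
  by exists x => b; rewrite A0 => -[->|].
have [|x xP] := satA X x0 (fun b i x => P b i x /\ P a i x).
  move=> F FA; have aFA : [set` (a |` F)%fset] `<=` a |` A.
    by move=> b /=; rewrite !inE => /predU1P[->|/FA]; [left|right].
  apply: filterS (Pfin _ aFA) => i [x xP]; exists x => b bF.
  by split; apply: xP; rewrite !inE ?eqxx ?bF ?orbT.
by exists x => b [->|/xP]; [move: (xP _ Ab0)|]; apply: filterS => i [].
Qed.

Lemma saturated_finite (A : set L) : finite_set A -> saturated A.
Proof.
move=> /finite_fsetP[F ->] X x0 P Pfin.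
have [x xP] := filter_choice x0 (Pfin F (fun _ => id)).
by exists x => b bF; apply: filterS xP => i; apply.
Qed.

End Saturation.

(** * From treetops to saturation *)

Unset Implicit Arguments.

Section Core.
Variables (L : choiceType) (D : set_system L).
Context {UD : UltraFilter D}.
Variable lt : L -> L -> Prop.
Hypotheses (wo : well_order_lt lt) (tops : treetops D).
Local Notation below a := [set b | lt b a].

Lemma lt_trans a b c : lt a b -> lt b c -> lt a c.
Proof. by have [+ _ _] := wo; apply. Qed.

Lemma lt_wf : well_founded lt.
Proof. by have [] := wo. Qed.

Lemma lt_total a b : [\/ lt a b, a = b | lt b a].
Proof.
have [_ tot _] := wo.
by case: (tot a b) => [|[]]; [constructor 1|constructor 2|constructor 3].
Qed.

Let DI (A B : set L) : D A -> D B -> D (A `&` B).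
Proof. exact: filterI. Qed.

(** * Internal sequences meeting more and more conditions *)

Section Sequence.
Variables (X : L -> Type) (R : forall i, X i -> X i -> Prop).
Variables (P : L -> forall i, X i -> Prop) (u : L -> forall i, X i).
Variable K : set L.
Hypothesis Rrefl : forall i x, R i x x.
Hypothesis Rtrans : forall i x y z, R i x y -> R i y z -> R i x z.
Hypothesis Kdown : forall b a, K a -> lt b a -> K b.
Hypothesis satK : forall a, K a -> saturated D (below a).
Hypothesis uR : forall b a, K a -> lt b a -> D [set i | R i (u b i) (u a i)].
Hypothesis uP : forall b a, K a -> b = a \/ lt b a -> D [set i | P b i (u a i)].

(* A node [(m, s)] is the finite sequence [s 0, ..., s m]. *)
Let node i : Type := (nat * (nat -> X i))%type.

Let node_le i (p q : node i) : Prop :=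
  (p.1 <= q.1)%N /\ forall k, (k <= p.1)%N -> p.2 k = q.2 k.

Let monotone_upto i (s : nat -> X i) (m : nat) : Prop :=
  forall j k, (j <= k)%N -> (k <= m)%N -> R i (s j) (s k).

(** Invariant of the recursion: earlier sequences survive as initial parts, and the condition of [b]
    is obeyed at every index after the end of [z b], not only where some [u a] stands. *)
Let stage a (z : L -> forall i, node i) (za : forall i, node i) : Prop :=
  [/\ D [set i | (za i).2 (za i).1 = u a i],
      D [set i | monotone_upto i (za i).2 (za i).1]
    & forall b, lt b a -> D [set i | node_le i (z b i) (za i) /\
        forall k, ((z b i).1 <= k <= (za i).1)%N -> P b i ((za i).2 k)]].

(** Initial parts of one sequence are comparable, so nodes form a forest and [tops] bounds the chain
    of the [z a]. The bound agrees with each [z a] up to its end and inherits its properties. *)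
Let top_exists z (A : set L) : A `<=` K -> A !=set0 -> (forall a, A a -> stage a z (z a)) ->
  exists t : forall i, node i,
    [/\ forall b, A b -> D [set i | node_le i (z b i) (t i)],
        forall b, A b -> D [set i | (t i).2 (z b i).1 = u b i],
        forall b, A b -> D [set i | monotone_upto i (t i).2 (z b i).1]
      & forall b c, A b -> A c -> D [set i | forall k,
          ((z b i).1 <= k <= (z c i).1)%N -> P b i ((t i).2 k)]].
Proof.
move=> AK A0 zA.
have z_le b c : lt b c -> A c -> D [set i | node_le i (z b i) (z c i)].
  by move=> bc Ac; have [_ _ /(_ b bc)] := zA c Ac; apply: filterS => i [].
have [||||b c Ab Ac|t zt] := tops node node_le _ _ _ A z _ _.
- by move=> i [m s]; split.
- move=> i [m s] [m' s'] [m'' s''] [/= mm' ss'] [/= m'm'' s's'']; split => /=.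
    exact: leq_trans m'm''.
  by move=> k km; rewrite ss' ?s's''//; exact: leq_trans mm'.
- move=> i [m s] [m' s'] [m'' s''] [/= mm'' ss''] [/= m'm'' s's''].
  have [mm'|/ltnW m'm] := leqP m m'; [left|right]; split => //= k km.
  + by rewrite ss'' ?s's''//; exact: leq_trans mm'.
  + by rewrite ss'' ?s's''//; exact: leq_trans m'm.
- exact: A0.
- have [bc|<-|cb] := lt_total b c.
  + by apply: filterS (z_le _ _ bc Ac) => i; left.
  + by apply: filterE => i; left; split.
  + by apply: filterS (z_le _ _ cb Ab) => i; right.
have tu b : A b -> D [set i | (t i).2 (z b i).1 = u b i].
  move=> Ab; have [+ _ _] := zA b Ab.
  by apply: filterS2 (zt b Ab) => i [_ tE] /= <-; rewrite tE.
exists t; split => //.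
  move=> c Ac; have [_ + _] := zA c Ac; apply: filterS2 (zt c Ac) => i [cN tE] cmono.
  move=> j k jk kc; rewrite -!tE//; first exact: cmono.
  exact: leq_trans kc.
(* If [c] does not come after [b], the interval has at most one index, and the term there is
   [u b]. *)
move=> b c Ab Ac; have Pbb : D [set i | P b i ((t i).2 (z b i).1)].
  by apply: filterS2 (tu b Ab) (uP b b (AK b Ab) (or_introl erefl)) => i /= ->.
have [bc|cb] : lt b c \/ (b = c \/ lt c b) by case: (lt_total b c); auto.
  have [_ _ /(_ b bc)] := zA c Ac; apply: filterS2 (zt c Ac).
  by move=> i [_ tE] [_ zP'] k /andP[bk kc]; rewrite -tE//; apply: zP'; rewrite bk.
have : D [set i | ((z c i).1 <= (z b i).1)%N].
  case: cb => [->|cb]; first by apply: filterE => i /=; exact: leqnn.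
  by apply: filterS (z_le _ _ cb Ab) => i [].
apply: filterS2 Pbb => i Pb cbi k /andP[bk kc].
by rewrite (_ : k = (z b i).1)//; apply/eqP; rewrite eqn_leq bk (leq_trans kc).
Qed.

(** The bound [t] of the earlier sequences may violate the conditions further on. Saturation of
    [below a] cuts it at an index [m] past all their ends where everything still holds, and [u a] is
    appended. *)
Let stage_family : exists z : L -> forall i, node i, forall a, K a -> stage a z (z a).
Proof.
have [|z zP] := @wf_choice L (forall i, node i) lt lt_wf (fun i => (0%N, fun _ => u i i)) stage.
  move=> a f g za fg [za1 za2 za3]; split => // b ba.
  by rewrite -fg//; exact: za3.
exists z; elim/(well_founded_ind lt_wf) => a IH Ka; apply: zP.
have Kb b : lt b a -> K b by exact: Kdown.
have [below0|/set0P[a0 a0a]] := eqVneq (below a) set0.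
  exists (fun i => (0%N, fun _ => u a i)); split.
  - by apply: filterE.
  - by apply: filterE => i j k _ _; exact: Rrefl.
  - move=> b ba; have : below a b by [].
    by rewrite below0.
have [t [zt tu tmono tP]] : exists t, _ := top_exists z (below a) Kb (ex_intro _ a0 a0a)
  (fun b ba => IH b ba (Kb b ba)).
have [F Fa|m mP] := satK a Ka (fun _ => nat) (fun _ => 0%N) (fun b i m =>
    [/\ ((z b i).1 <= m <= (t i).1)%N, monotone_upto i (t i).2 m, R i ((t i).2 m) (u a i)
      & forall k, ((z b i).1 <= k <= m)%N -> P b i ((t i).2 k)]).
  have : D [set i | forall c, c \in F ->
      [/\ ((z c i).1 <= (t i).1)%N, monotone_upto i (t i).2 (z c i).1,
          R i ((t i).2 (z c i).1) (u a i)
        & forall b, b \in F ->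
          forall k, ((z b i).1 <= k <= (z c i).1)%N -> P b i ((t i).2 k)]].
    apply: filter_fset => c /Fa ca.
    have tPc : D [set i | forall b, b \in F ->
        forall k, ((z b i).1 <= k <= (z c i).1)%N -> P b i ((t i).2 k)].
      by apply: filter_fset => b /Fa ba; exact: tP.
    have good := DI _ _ (DI _ _ (zt c ca) (tmono c ca)) (DI _ _ (tu c ca) (uR c a Ka ca)).
    apply: filterS2 tPc good => i tPc' [[[cN tE] cmono] [tuc Ruc]]; split => //.
    by rewrite tuc.
  apply: filterS => i Fi; have [F0|[b0 b0F]] := fset_0Vmem F.
    by exists 0%N => b; rewrite F0 inE.
  (* Finitely many requirements are met at the end of the longest sequence involved. *)
  have [||c cF cmax] := @seq_max L (fun b c => (z b i).1 <= (z c i).1)%N F b0 _ _ b0F.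
  - by move=> x y w; exact: leq_trans.
  - by move=> x y _ _; apply/orP; exact: leq_total.
  exists (z c i).1 => b bF; have [cN cmono cR cP] := Fi c cF.
  by split => //; [rewrite cmax|exact: cP].
exists (fun i => ((m i).+1, fun k => if (k <= m i)%N then (t i).2 k else u a i)); split.
- by apply: filterE => i /=; rewrite ltnn.
- apply: filterS (mP a0 a0a) => i [_ mono mR _] j k jk /= km.
  have [km'|mk] := leqP k (m i); first by rewrite (leq_trans jk km'); exact: mono.
  by case: leqP => // jm; apply: Rtrans mR; apply: mono.
- move=> b ba; apply: filterS2 (zt b ba) (filterI (mP b ba) (uP b a Ka (or_intror ba))).
  move=> i [_ tE] [[/andP[bm _] _ _ mPb] Pu]; split.
    split => /= [|k kb]; first exact: leqW.
    by rewrite (leq_trans kb bm) tE.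
  move=> k /= /andP[bk km]; case: leqP => // km'.
  by apply: mPb; rewrite bk.
Qed.

(** A bound of the family over all of [K]. Cutting it at the last [N i] up to which it is monotone
    gives monotonicity in every coordinate and keeps [N] above each [n a] in the ultrapower. *)
Lemma internal_sequence : K !=set0 ->
  exists (N : L -> nat) (s : forall i, nat -> X i) (n : L -> L -> nat),
    [/\ forall a, K a -> D [set i | (n a i <= N i)%N /\ s i (n a i) = u a i],
        forall b a, K a -> lt b a -> D [set i | (n b i <= n a i)%N],
        forall i, monotone_upto i (s i) (N i)
      & forall b a, K b -> K a ->
          D [set i | forall k, (n b i <= k <= n a i)%N -> P b i (s i k)]].
Proof.
move=> K0; have [z zK] := stage_family.
have [t [zt tu tmono tP]] := top_exists z K (fun _ => id) K0 zK.
pose mono i : set nat := [set m | monotone_upto i (t i).2 m].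
have mono0 i : mono i 0%N.
  by move=> j k; rewrite leqn0 => jk /eqP k0; move: jk; rewrite k0 leqn0 => /eqP ->.
exists (fun i => max_below (mono i) (t i).1), (fun i => (t i).2), (fun a i => (z a i).1).
split.
- move=> a Ka; have good := DI _ _ (zt a Ka) (tu a Ka).
  apply: filterS2 good (tmono a Ka) => i [[an _] tua] ma; split => //.
  by have [_ _] := max_belowP (mono0 i) (leq0n (t i).1); apply.
- by move=> b a Ka ba; have [_ _ /(_ b ba)] := zK a Ka; apply: filterS => i [[]].
- by move=> i; have [] := max_belowP (mono0 i) (leq0n (t i).1).
- exact: tP.
Qed.

End Sequence.

(** * Gaps in the ultrapower of omega *)

Section Segment.
Variable K : set L.
Hypothesis K0 : K !=set0.
Hypothesis Kdown : forall b a, K a -> lt b a -> K b.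
Hypothesis satK : forall a, K a -> saturated D (below a).

Lemma ultra_leqVgt (x y : L -> nat) :
  D [set i | (x i <= y i)%N] \/ D [set i | (y i < x i)%N].
Proof.
have [|nD] := in_ultra_setVsetC [set i | (x i <= y i)%N] UD; first by left.
by right; apply: filterS nD => i /= /negP; rewrite -ltnNge.
Qed.

Lemma symmetric_gap_filled (a d : L -> L -> nat) :
  (forall b c, K c -> lt b c -> D [set i | (a b i <= a c i)%N /\ (d c i <= d b i)%N]) ->
  (forall b c, K b -> K c -> D [set i | (a b i <= d c i)%N]) ->
  exists m : L -> nat, forall b, K b -> D [set i | (a b i <= m i <= d b i)%N].
Proof.
move=> nested ad.
(* Inclusion of intervals, the inner one nonempty: its left end then lies in the outer one. So the
   left end of the last interval of an internal sequence fills the gap. *)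
pose R (i : L) (p q : nat * nat) :=
  p = q \/ [/\ (p.1 <= q.1)%N, (q.2 <= p.2)%N & (q.1 <= q.2)%N].
have [|||||||N [s [n [sN _ smono _]]]] := @internal_sequence (fun _ => (nat * nat)%type) R
  (fun _ _ _ => True) (fun b i => (a b i, d b i)) K.
- by move=> i x; left.
- move=> i x y z [->//|[xy1 xy2 xy3]] [<-|[yz1 yz2 yz3]]; right => //.
  by split => //; [exact: leq_trans yz1|exact: leq_trans xy2].
- exact: Kdown.
- exact: satK.
- move=> b c Kc bc; apply: filterS2 (nested b c Kc bc) (ad c c Kc Kc) => i [ab db] abd.
  by right.
- by move=> b c _ _; exact: filterE.
- exact: K0.
exists (fun i => (s i (N i)).1) => b Kb.
apply: filterS2 (sN b Kb) (ad b b Kb Kb) => i [nN snE] abd.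
have := smono i (n b i) (N i) nN (leqnn _); rewrite snE /= => -[<-|[/= -> yd xy]] /=.
  by rewrite leqnn.
exact: leq_trans yd.
Qed.

(** The upper half is indexed by a cardinal [below x] smaller than [K]. Were the gap unfilled, the
    successor cardinal of [below x] would inject into the square of [below x]. *)
Lemma asymmetric_gap_filled (x : L) (e d : L -> L -> nat) :
  K x -> infinite_set (below x) -> ~ (K #<= below x) ->
  (forall g, lt g x -> ~ (below x #<= below g)) ->
  (forall b c, K c -> lt b c -> D [set i | (e b i <= e c i)%N]) ->
  (forall g h, lt h x -> lt g h -> D [set i | (d h i <= d g i)%N]) ->
  (forall b g, K b -> lt g x -> D [set i | (e b i <= d g i)%N]) ->
  exists m : L -> nat, forall b g, K b -> lt g x -> D [set i | (e b i <= m i <= d g i)%N].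
Proof.
move=> Kx xinf Kbig xcard emono dmono ed; apply: contrapT => nofill.
(* An initial segment of [K] of the order type of the successor cardinal of [below x]. *)
pose W : set L := [set w | K w /\ below w #<= below x].
have /choice[j jP] w : exists j : L -> L,
    W w -> set_fun (below w) (below x) j /\ set_inj (below w) j.
  have [[_ /(card_le_injP x)[j j1 j2]]|nW] := pselect (W w); first by exists j.
  by exists id.
pose C i (Y : set L) (v : nat) : Prop :=
  forall z w, W w -> Y z -> Y w -> lt z w -> (v <= d (j w z) i)%N.
have dj z w : W w -> lt z w -> lt (j w z) x by move=> Ww; have [+ _] := jP w Ww; apply.
(* [Y a] contains the points of [W] up to [a] and has colours at least [e a]. Finitely many points
   form such a set themselves, since all colours lie above the lower half. *)
have /choice[Y YP] a : exists Y : forall i : L, set L, K a ->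
    forall b, b = a \/ lt b a -> D [set i | (W b -> Y i b) /\ C i (Y i) (e a i)].
  have [Ka|nKa] := pselect (K a); last by exists (fun _ => set0).
  have [F Fa|Y YP] := @saturatedU1 L D UD (below a) a (satK a Ka) (fun _ => set L) (fun _ => set0)
    (fun b i Y => (W b -> Y b) /\ C i Y (e a i)); last by exists Y.
  have : D [set i | forall z, z \in F -> forall w, w \in F -> W w -> lt z w ->
      (e a i <= d (j w z) i)%N].
    apply: filter_fset => z zF; apply: filter_fset => w wF.
    have [[Ww zw]|nWzw] := pselect (W w /\ lt z w).
      by apply: filterS (ed a _ Ka (dj z w Ww zw)).
    by apply: filterE => i Ww zw; case: nWzw.
  apply: filterS => i Fi; exists [set` F] => b bF; split => // z w Ww zF wF zw.
  exact: Fi.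
have [|||||||N [s [n [sN nmono smono sP]]]] := @internal_sequence (fun _ => (set L * nat)%type)
  (fun i p q => (p.2 <= q.2)%N) (fun b i p => (W b -> p.1 b) /\ C i p.1 p.2)
  (fun a i => (Y a i, e a i)) K.
- by [].
- by move=> i p q r; exact: leq_trans.
- exact: Kdown.
- exact: satK.
- exact: emono.
- by move=> b a Ka; exact: YP.
- exact: K0.
(* [m g] is the last index whose level is at most [d g]; [n' b] will be the last one up to which
   condition [b] has held since [n b]. *)
pose m g i := max_below [set k | ((s i k).2 <= d g i)%N] (N i).
have mP b g : K b -> lt g x ->
    D [set i | [/\ (n b i <= m g i)%N, (m g i <= N i)%N & ((s i (m g i)).2 <= d g i)%N]].
  move=> Kb gx; apply: filterS2 (sN b Kb) (ed b g Kb gx) => i [nN sE] ebd.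
  have [|mQ mN mmax] := @max_belowP [set k | ((s i k).2 <= d g i)%N] (N i) (n b i) _ nN.
    by rewrite /= sE.
  by split => //; apply: mmax; rewrite // /= sE.
pose run b i : set nat := [set k | forall l, (n b i <= l <= k)%N ->
  (W b -> (s i l).1 b) /\ C i (s i l).1 (s i l).2].
pose n' b i := max_below (run b i) (N i).
have n'P b c : K b -> K c ->
    D [set i | [/\ (n c i <= n' b i)%N, (n' b i <= N i)%N & run b i (n' b i)]].
  move=> Kb Kc; apply: filterS2 (sN c Kc) (sP b c Kb Kc) => i [nN _] runc.
  by have [r n'N n'max] := max_belowP (Q := run b i) runc nN; split => //; apply: n'max.
(* If [n' w] came before every [m g], the level reached there would fill the gap. *)
have /choice[h hP] w : exists g, W w -> lt g x /\ D [set i | (m g i <= n' w i)%N].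
  have [Ww|nW] := pselect (W w); last by exists x.
  have [Kw _] := Ww.
  apply: contrapT => noh; apply: nofill; exists (fun i => (s i (n' w i)).2) => b g Kb gx.
  have : D [set i | (n' w i < m g i)%N].
    by case: (ultra_leqVgt (m g) (n' w)) => // mg; case: noh; exists g.
  move=> n'm; have good := DI _ _ (sN b Kb) (n'P w b Kw Kb).
  apply: filterS2 good (DI _ _ n'm (mP b g Kb gx)) => i [[nN sE] [nn' n'N _]] [/= n'mg [_ mN md]].
  have := smono i _ _ nn' n'N; rewrite sE => /= -> /=.
  by apply: leq_trans md; apply: smono => //; exact: ltnW.
(* Likewise the level at [m g] would fill the gap if no [d h] lay below it. *)
have /choice[t tP] g : exists h, lt g x -> lt h x /\ D [set i | (d h i < (s i (m g i)).2)%N].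
  have [gx|ngx] := pselect (lt g x); last by exists x.
  apply: contrapT => not_; apply: nofill; exists (fun i => (s i (m g i)).2) => b h' Kb hx.
  have : D [set i | ((s i (m g i)).2 <= d h' i)%N].
    by case: (ultra_leqVgt (fun i => (s i (m g i)).2) (d h')) => // lth; case: not_; exists h'.
  apply: filterS2 (DI _ _ (sN b Kb) (mP b g Kb gx)) => i [[nN sE] [nm mN _]] /= ->.
  by rewrite andbT; have := smono i _ _ nm mN; rewrite sE.
pose A g : set L := [set w | W w /\ h w = g].
(* At index [m g] both [z] and [w] belong to the set, so their colour is at least the level there,
   hence above [d (t g)]; as [d] decreases, [j w z] precedes [t g]. *)
have Aseg z w g : A g z -> A g w -> lt z w -> lt (j w z) (t g).
  move=> [Wz hz] [Ww hw] zw; have [Kz _] := Wz; have [Kw _] := Ww.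
  have [gx mz] := hP z Wz; have [_ mw] := hP w Ww; rewrite hz in gx mz; rewrite hw in mw.
  have [tx dt] := tP g gx.
  have dle : D [set i | ((s i (m g i)).2 <= d (j w z) i)%N].
    have good1 := DI _ _ (mP z g Kz gx) (n'P z z Kz Kz).
    have good2 := DI _ _ (mP w g Kw gx) (n'P w w Kw Kw).
    apply: filterS2 (DI _ _ good1 mz) (DI _ _ good2 mw).
    move=> i [[[nmz _ _] [_ _ rz]] /= mnz] [[[nmw _ _] [_ _ rw]] /= mnw].
    have [|/(_ Wz) Yz CY] := rz (m g i); first by rewrite nmz.
    have [|/(_ Ww) Yw _] := rw (m g i); first by rewrite nmw.
    exact: CY Yz Yw zw.
  case: (lt_total (j w z) (t g)) => // jt.
    have : D set0 by apply: filterS2 dt dle => i /= dlt; rewrite jt leqNgt dlt.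
    by move/filter_not_empty.
  have : D set0; last by move/filter_not_empty.
  apply: filterS2 (DI _ _ dt dle) (dmono _ _ (dj z w Ww zw) jt).
  move=> i [/= lt1 le1] /= le2.
  by have := leq_trans (leq_trans lt1 le1) le2; rewrite ltnn.
(* Through [j w] the part of a class before [w] injects into [below (t g)], which is smaller than
   [below x]. *)
have Acard g : lt g x -> A g #<= below x.
  move=> gx; apply: (card_le_of_initial_segments wo) => w [Ww hw] xA.
  have [tx _] := tP g gx; apply: (xcard (t g) tx); apply: card_le_trans xA _.
  apply/(card_le_injP x); exists (j w).
    by move=> z [Az zw]; apply: Aseg => //; split.
  move=> z z' /set_mem[_ zw] /set_mem[_ z'w]; have [_ jinj] := jP w Ww.
  by apply: jinj; exact: mem_set.
have /choice[r rP] g : exists r : L -> L, lt g x -> set_fun (A g) (below x) r /\ set_inj (A g) r.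
  have [gx|ngx] := pselect (lt g x); last by exists id.
  by have /(card_le_injP x)[r r1 r2] := Acard g gx; exists r.
(* A point of [W] is determined by its class and its image under the injection of that class. *)
have Wx : W #<= below x.
  apply: card_le_trans _ (hessenberg wo xinf).
  apply/(card_le_injP (x, x)); exists (fun w => (h w, r (h w) w)).
    move=> w Ww; have [hx _] := hP w Ww; split => //=.
    by have [+ _] := rP _ hx; apply.
  move=> w w' /set_mem Ww /set_mem Ww' [hw rw]; have [hx _] := hP w Ww.
  have [_ rinj] := rP _ hx; apply: rinj; rewrite ?inE /A /=; last by rewrite {2}hw.
  - by [].
  - by rewrite hw.
(* Hence [W] is not all of [K]. But the least point of [K] outside [W] has all its predecessors in
   [W], too few for it to be outside. *)
have [w Kw nW] : exists2 w, K w & ~ W w.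
  apply: contrapT => KW; apply: Kbig; apply: card_le_trans Wx; apply: subset_card_le => w Kw.
  by apply: contrapT => nW; apply: KW; exists w.
have [v [Kv nWv] vmin] := wf_min lt_wf (A := [set w | K w /\ ~ W w]) (conj Kw nW).
apply: nWv; split => //; apply: card_le_trans Wx; apply: subset_card_le => z zv.
by apply: contrapT => nWz; apply: (vmin z zv); split => //; exact: Kdown zv.
Qed.

Lemma saturated_segment : saturated D K.
Proof.
have [[x Kx Kx_le]|Kbig] := pselect (exists2 x, K x & K #<= below x).
  exact: saturated_card_le Kx_le (satK x Kx).
move=> X x0 P Pfin.
have /choice[u uP] a : exists u : forall i, X i, K a ->
    forall b, b = a \/ lt b a -> D [set i | P b i (u i)].
  have [Ka|nKa] := pselect (K a); last by exists x0.
  have [F Fa|u uP] := @saturatedU1 L D UD (below a) a (satK a Ka) X x0 P; last by exists u.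
  by apply: Pfin => b /Fa[->|]//; exact: Kdown.
have [|||||||N [s [n [sN nmono _ sP]]]] := @internal_sequence X (fun _ _ _ => True) P u K.
- by [].
- by [].
- exact: Kdown.
- exact: satK.
- by move=> b a _ _; exact: filterE.
- by move=> b a Ka; exact: uP.
- exact: K0.
pose run b i : set nat := [set k | forall l, (n b i <= l <= k)%N -> P b i (s i l)].
pose n' b i := max_below (run b i) (N i).
have n'P b c : K b -> K c -> D [set i | (n c i <= n' b i)%N /\ run b i (n' b i)].
  move=> Kb Kc; apply: filterS2 (sN c Kc) (sP b c Kb Kc) => i [nN _] runc.
  by have [r n'N n'max] := max_belowP (Q := run b i) runc nN; split => //; apply: n'max.
(* Any [m] between the [n b] and the [n' b] picks a term satisfying every condition, so a failure of
   saturation is an unfilled gap. *)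
suff [m mP] : exists m : L -> nat, forall b, K b -> D [set i | (n b i <= m i <= n' b i)%N].
  exists (fun i => s i (m i)) => b Kb; apply: filterS2 (mP b Kb) (n'P b b Kb Kb).
  by move=> i nmn' [_ runb]; exact: runb.
apply: contrapT => nofill.
pose coinitial (A : set L) := exists2 r : L -> L, (forall g, A g -> K (r g)) &
  forall b, K b -> exists2 g, A g & D [set i | (n' (r g) i <= n' b i)%N].
(* This will make the least index segment, when it is some [below x], a cardinal: no shorter segment
   has as many points. *)
have coinitial_card_le (A B : set L) : A #<= B -> coinitial A -> coinitial B.
  have [a0 Ka0] := K0; move=> /(card_le_injP a0)[f fAB finj] [r rK rP].
  have [b1 Ab1 _] := rP a0 Ka0.
  pose g c := xget b1 [set b | A b /\ f b = c].
  have gA c : A (g c) by rewrite /g; case: xgetP => [b -> []|].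
  exists (fun c => r (g c)) => [c _|b Kb]; first exact: rK.
  have [c Ac cb] := rP b Kb; exists (f c); first exact: fAB.
  have [Agfc fgfc] : A (g (f c)) /\ f (g (f c)) = f c.
    by apply: (@xgetPex _ b1 [set b | A b /\ f b = f c]); exists c.
  by rewrite (finj (g (f c)) c) // mem_set.
have Kcoinitial : coinitial K.
  by exists id => // b Kb; exists b => //; apply: filterE => i /=; exact: leqnn.
have [T [TK Tdown Tco Tmin]] : exists T : set L,
    [/\ T = K \/ exists2 x, K x & T = below x, forall g h, T g -> lt h g -> T h, coinitial T
      & forall g, T g -> ~ coinitial (below g)].
  have [[x [Kx xco]]|noco] := pselect (exists x, K x /\ coinitial (below x)).
    have [y [Ky yco] ymin] :=
      wf_min lt_wf (A := [set x | K x /\ coinitial (below x)]) (conj Kx xco).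
    exists (below y); split => //; first by right; exists y.
      by move=> g h /= gy hg; exact: lt_trans gy.
    by move=> g gy gco; apply: (ymin g gy); split => //; exact: Kdown gy.
  exists K; split => //; first by left.
    by move=> g h Kg; exact: Kdown.
  by move=> g Kg gco; apply: noco; exists g.
have [r rK rP] := Tco.
(* A strictly decreasing coinitial family, extracted from [n' (r g)]. *)
have [a0 Ka0] := K0.
have [|q qP] := @wf_choice L L lt lt_wf a0 (fun g q z => [/\ K z,
    D [set i | (n' z i <= n' (r g) i)%N]
    & forall h, lt h g -> D [set i | (n' z i < n' (q h) i)%N]]).
  by move=> g q q' z qq' [Kz zr zq]; split => // h hg; rewrite -qq'//; exact: zq.
have {}qP g : T g -> [/\ K (q g), D [set i | (n' (q g) i <= n' (r g) i)%N]
    & forall h, lt h g -> D [set i | (n' (q g) i < n' (q h) i)%N]].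
  elim/(well_founded_ind lt_wf): g => g IH Tg; apply: qP.
  (* By minimality of [T] the earlier values are not coinitial, so some [n' b] lies strictly below
     all of them. *)
  have [b Kb bq] : exists2 b, K b & forall h, lt h g -> D [set i | (n' b i < n' (q h) i)%N].
    apply: contrapT => nob; apply: (Tmin g Tg); exists q.
      by move=> h hg; have [] := IH h hg (Tdown g h Tg hg).
    move=> b Kb; apply: contrapT => nog; apply: nob; exists b => // h hg.
    by case: (ultra_leqVgt (n' (q h)) (n' b)) => // qb; case: nog; exists h.
  case: (ultra_leqVgt (n' b) (n' (r g))) => [br|rb]; first by exists b.
  exists (r g); split; [exact: rK|by apply: filterE => i /=; exact: leqnn|].
  by move=> h hg; apply: filterS2 rb (bq h hg) => i /=; exact: ltn_trans.
have qco b : K b -> exists2 g, T g & D [set i | (n' (q g) i <= n' b i)%N].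
  move=> Kb; have [g Tg gb] := rP b Kb; exists g => //.
  by have [_ qr _] := qP g Tg; apply: filterS2 qr gb => i /=; exact: leq_trans.
have nq b g : K b -> T g -> D [set i | (n b i <= n' (q g) i)%N].
  by move=> Kb Tg; have [Kq _ _] := qP g Tg; apply: filterS (n'P _ b Kq Kb) => i [].
have fill (m : L -> nat) : ~ (forall b g, K b -> T g -> D [set i | (n b i <= m i <= n' (q g) i)%N]).
  move=> mP; apply: nofill; exists m => b Kb; have [g Tg gb] := qco b Kb.
  apply: filterS2 gb (mP b g Kb Tg) => i /= gb' /andP[-> mg]; exact: leq_trans gb'.
have qmono g h : T h -> lt g h -> D [set i | (n' (q h) i <= n' (q g) i)%N].
  by move=> Th gh; have [_ _ /(_ g gh)] := qP h Th; apply: filterS => i; exact: ltnW.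
case: TK => [TK|[x Kx Tx]].
  have [||m mP] := @symmetric_gap_filled n (fun g => n' (q g)).
  - by move=> b c Kc bc; apply: DI; [exact: nmono|apply: qmono; rewrite ?TK].
  - by move=> b c Kb Kc; apply: nq; rewrite ?TK.
  apply: (fill m) => b g Kb Tg; rewrite TK in Tg.
  (* Off the diagonal, the interval of the later index serves for both. *)
  have [bg|->|gb] := lt_total b g.
  - apply: filterS2 (mP g Tg) (nmono b g Tg bg) => i /andP[gm mg] /= bg'.
    by rewrite mg andbT; exact: leq_trans gm.
  - exact: mP.
  - apply: filterS2 (mP b Kb) (qmono g b _ gb); rewrite ?TK // => i /andP[nm mb] /= qq.
    by rewrite nm; exact: leq_trans mb qq.
subst T.
have [g1 xg1 _] := qco a0 Ka0.
(* A finite upper half would have a least element, which would itself fill the gap. *)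
have xinf : infinite_set (below x).
  move=> /finite_fsetP[F FE].
  have [|||c cF cmax] := @seq_max L (fun g h => g = h \/ lt g h) F g1.
  - by move=> g h k [->|gh] // [<-|hk]; right => //; exact: lt_trans hk.
  - by move=> g h _ _; case: (lt_total g h); auto.
  - by have : below x g1 by []; rewrite FE.
  have xc : below x c by rewrite FE.
  apply: (fill (n' (q c))) => b g Kb xg; have : g \in F by have := xg; rewrite FE.
  move=> /cmax[->|gc]; first by apply: filterS (nq b c Kb xc) => i /= ->; rewrite leqnn.
  by apply: filterS2 (nq b c Kb xc) (qmono g c xc gc) => i /= ->.
have [|||||m mP] := @asymmetric_gap_filled x n (fun g => n' (q g)) Kx xinf.
- by move=> xK; apply: Kbig; exists x.
- by move=> g gx xg; apply: (Tmin g gx); exact: coinitial_card_le xg Tco.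
- exact: nmono.
- by move=> g h hx gh; exact: qmono.
- exact: nq.
- exact: fill mP.
Qed.

End Segment.

(** Induction along [lt]: an initial segment is saturated once its proper initial segments are, and
    [L] is an initial segment of itself. *)
Lemma saturatedT : saturated D [set: L].
Proof.
have step K : (forall b a, K a -> lt b a -> K b) ->
    (forall a, K a -> saturated D (below a)) -> saturated D K.
  move=> Kdown satK; have [->|/set0P K0] := eqVneq K set0.
    exact: saturated_finite (finite_set0 _).
  exact: saturated_segment.
apply: (step) => // a _; elim/(well_founded_ind lt_wf): a => a IH.
by apply: step => // b c /= ca bc; exact: lt_trans ca.
Qed.

End Core.

Set Implicit Arguments.

(** * Goodness *)

Lemma dependent_choice {I : Type} {X : I -> Type} (Q : forall i, X i -> Prop) :
  (forall i, exists x, Q i x) -> exists x : forall i, X i, forall i, Q i (x i).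
Proof. by move=> QX; exists (fun i => projT1 (cid (QX i))) => i; case: cid. Qed.

Section Goodness.
Variables (L : choiceType) (D : set_system L).
Context {UD : UltraFilter D}.

(** Indexed by [L], the family attaches a set [E a] to each condition [a], so that only finitely
    many conditions are active at a coordinate. *)
Lemma regular_family : regular D -> exists E : L -> set L,
  (forall a, D (E a)) /\ forall i, finite_set [set a | E a i].
Proof.
move=> [S [SD]]; rewrite card_eq_sym => /pcard_eqP/bijPex[E [ES Einj _]] Sfin.
have SE a : S (E a) by exact: ES.
exists E; split => [a|i]; first exact: SD.
apply: (@sub_finite_set _ _ (E @^-1` [set e | S e /\ e i])); first by move=> a Eai.
by apply: finite_preimage (Sfin i) => a b _ _; apply: Einj; rewrite inE.
Qed.

Lemma multiplicativeE (g : {fset L} -> set L) (F : {fset L}) :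
  (forall d e, g (d `|` e)%fset = g d `&` g e) -> F != fset0 ->
  g F = [set i | forall a, a \in F -> g [fset a]%fset i].
Proof.
move=> gM; elim/fset1U_rect: F => [|a F _ IH] F0; first by rewrite eqxx in F0.
have [->|/IH gF] := eqVneq (F : {fset L}) fset0.
  rewrite fsetU0; apply/seteqP; split=> i.
    by move=> ga b; rewrite inE => /eqP ->.
  by apply; rewrite inE.
rewrite gM gF; apply/seteqP; split=> i.
  by move=> [ga gFi] b; rewrite !inE => /predU1P[->|/gFi].
move=> h; split; first by apply: h; rewrite !inE eqxx.
by move=> b bF; apply: h; rewrite !inE bF orbT.
Qed.

(** [f d] collects the coordinates where the conditions in [d] are jointly solvable and active. A
    refinement [g] selects at [i] a finite set of conditions, and multiplicativity makes that whole
    set solvable at [i]. *)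
Lemma good_saturated : regular D -> good D -> saturated D [set: L].
Proof.
move=> /regular_family[E [DE Efin]] goodD X x0 P Pfin.
pose f (d : {fset L}) : set L :=
  [set i | (exists x, forall b, b \in d -> P b i x) /\ forall b, b \in d -> E b i].
have [||g [gD gf gM]] := goodD f.
- by move=> d; apply: filterI; [exact: Pfin|exact: filter_fset].
- move=> d e /fsubsetP de i [[x xP] eE]; split; last by move=> b /de/eE.
  by exists x => b /de/xP.
have /dependent_choice[x xP] i : exists x, forall b, g [fset b]%fset i -> P b i x.
  have [F FE] : exists F : {fset L}, [set a | g [fset a]%fset i] = [set` F].
    apply/finite_fsetP; apply: sub_finite_set (Efin i) => a /gf[_]; apply.
    by rewrite inE.
  have [F0|[b0 b0F]] := fset_0Vmem F.
    exists (x0 i) => b gb; have : [set a | g [fset a]%fset i] b by [].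
    by rewrite FE F0 /= inE.
  have /gf[[x xP] _] : g F i.
    rewrite multiplicativeE //; last by apply/fset0Pn; exists b0.
    by move=> a aF; have : [set` F] a by []; rewrite -FE.
  exists x => b gb; apply: xP; have : [set a | g [fset a]%fset i] b by [].
  by rewrite FE.
by exists x => b _; apply: filterS (gD [fset b]%fset) => i; exact: xP.
Qed.

(** Saturation yields finite sets [s i] with [i] in [f (s i)] that contain each [b] almost
    everywhere; the refinement asks that [d] be contained in [s i]. *)
Lemma saturated_good : infinite_set [set: L] -> saturated D [set: L] -> good D.
Proof.
move=> /infinite_setN0[a0 _] satD f fD fmono.
have [F _|s sP] := satD (fun _ => {fset L}) (fun _ => fset0) (fun b i s => b \in s /\ f s i).
  by apply: filterS (fD F) => i fFi; exists F => b bF.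
exists (fun d => [set i | f (s i) i /\ forall b, b \in d -> b \in s i]); split.
- move=> d; apply: filterI; first by apply: filterS (sP a0 I) => i [].
  by apply: filter_fset => b _; apply: filterS (sP b I) => i [].
- by move=> d i [fs ds]; apply: fmono fs; apply/fsubsetP.
- move=> d e; apply/seteqP; split=> i.
    by move=> [fs des]; split; split => // b bd; apply: des; rewrite inE bd ?orbT.
  by move=> [[fs ds] [_ es]]; split => // b; rewrite inE => /orP[/ds|/es].
Qed.

Lemma treetops_of_refinements : regular D ->
  (forall f : {fset L} -> set L, into D f -> graph_like f ->
     (forall x0 x1 x2 x3 : L, uniq [:: x0; x1; x2; x3] ->
        f [fset x0; x1]%fset `&` f [fset x1; x2]%fset `&` f [fset x2; x3]%fset
          `<=` f [fset x0; x2]%fset `|` f [fset x1; x3]%fset) ->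
     has_multiplicative_refinement D f) ->
  treetops D.
Proof.
move=> /regular_family[E [DE Efin]] refine Z le lexx letr leforest A s0 [a0 Aa0] s0cmp.
pose s a := if pselect (A a) then s0 a else s0 a0.
pose cmp i a b := le i (s a i) (s b i) \/ le i (s b i) (s a i).
have Dcmp a b : D [set i | cmp i a b].
  by rewrite /cmp /s; case: pselect => Aa; case: pselect => Ab; exact: s0cmp.
have cmpxx i a : cmp i a a by left.
have cmpC i a b : cmp i a b -> cmp i b a by case; [right|left].
(* Graph-likeness leaves sets of at most one element free; sending singletons into the regular
   family makes each [K i] below finite, so its pairwise comparable elements have a maximum. *)
pose f (d : {fset L}) : set L :=
  if (#|` d| <= 1)%N then [set i | forall a, a \in d -> E a i]
  else [set i | forall a, a \in d -> forall b, b \in d -> cmp i a b].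
have f2 a b : a != b -> f [fset a; b]%fset = [set i | cmp i a b].
  move=> ab; rewrite /f cardfs2 ab /=; apply/seteqP; split=> i /=.
    by apply; rewrite !inE eqxx ?orbT.
  move=> ci c + e; rewrite !inE => /orP[]/eqP-> /orP[]/eqP->;
    by [exact: cmpxx|exact: ci|apply: cmpC; exact: ci].
have [|d d2|x0 x1 x2 x3|g [gD gf gM]] := refine f.
- move=> d; rewrite /f; case: ifP => _; first by apply: filter_fset => a _; exact: DE.
  by apply: filter_fset => a _; apply: filter_fset => b _; exact: Dcmp.
- rewrite [LHS]/f leqNgt d2 /=; apply/seteqP; split=> i /=.
    move=> fd p [/fsubsetP pd p2]; rewrite /f p2 /= => a /pd ad b /pd bd; exact: fd.
  move=> fp a ad b bd; have [->//|ab] := eqVneq a b.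
  have : f [fset a; b]%fset i.
    apply: fp; split; last by rewrite cardfs2 ab.
    by apply/fsubsetP => c; rewrite !inE => /orP[]/eqP ->.
  by rewrite f2.
- rewrite /= !inE !negb_or => /and4P[/and3P[x01 x02 x03] /andP[x12 x13] x23 _].
  rewrite !f2 // => i [[c01 c12] c23] /=.
  (* Orient the middle edge. If the outer edge at its smaller end points down to that end,
     transitivity or the forest property gives a diagonal; otherwise the other outer edge does. *)
  have [le12|le21] : le i (s x1 i) (s x2 i) \/ le i (s x2 i) (s x1 i) by exact: c12.
    case: c01 => [le01|le10].
      by left; left; exact: letr le12.
    right; case: c23 => [le23|le32]; first by left; exact: letr le23.
    exact: leforest le12 le32.
  case: c23 => [le23|le32]; last by right; right; exact: letr le32 le21.
  left; case: c01 => [le01|le10]; first exact: leforest le01 le21.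
  by right; exact: letr le10.
pose K i : set L := [set a | g [fset a]%fset i].
have /dependent_choice[t tP] i : exists t, forall a, K i a -> le i (s a i) t.
  have [F FE] : exists F : {fset L}, K i = [set` F].
    apply/finite_fsetP; apply: sub_finite_set (Efin i) => a /gf.
    by rewrite /f cardfs1 /=; apply; rewrite inE.
  have KF a : K i a -> a \in F by rewrite FE.
  have FK a : a \in F -> K i a by rewrite FE.
  have [F0|[b0 b0F]] := fset_0Vmem F.
    by exists (s a0 i) => a /KF; rewrite F0 inE.
  have [|||c cF cmax] := @seq_max L (fun a b => le i (s a i) (s b i)) F b0.
  - by move=> x y z; exact: letr.
  - move=> x y /FK Kx /FK Ky; have [->|xy] := eqVneq x y; first by left.
    have : g [fset x; y]%fset i by rewrite gM; split.
    by move=> /gf; rewrite f2.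
  - by [].
  by exists (s c i) => a /KF; exact: cmax.
exists t => a Aa; apply: filterS (gD [fset a]%fset) => i /tP.
by rewrite /s; case: pselect.
Qed.

End Goodness.

(** * The theorem of Los *)

Section UltraproductClasses.
Local Open Scope quotient_scope.
Variables (L : Type) (D : set_system L) (FD : ProperFilter D) (X : L -> Type).

Lemma ucls_eqP (r s : forall i, X i) :
  ucls FD r = ucls FD s <-> D [set i | r i = s i].
Proof.
split=> [/(@eqmodP _ (ultra_equiv FD X))/asboolP//|Drs].
by apply/(@eqmodP _ (ultra_equiv FD X))/asboolP.
Qed.

Lemma urepK (x : ultraproduct FD X) : ucls FD (urep x) = x.
Proof. exact: (@reprK _ {eq_quot (ultra_equiv FD X)}). Qed.

Lemma urep_ucls (r : forall i, X i) : D [set i | urep (ucls FD r) i = r i].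
Proof. by apply/ucls_eqP; rewrite urepK. Qed.

Lemma urep_eqP (x y : ultraproduct FD X) : x = y <-> D [set i | urep x i = urep y i].
Proof. by rewrite -[x in x = _]urepK -[y in _ = y]urepK; exact: ucls_eqP. Qed.

End UltraproductClasses.

Section Los.
Variables (L : Type) (D : set_system L).
Context {UD : UltraFilter D}.
Variables (Lg : language) (M : structure Lg).
Local Notation MD := (ultrapower ultra_proper M).

Lemma ultrapower_eval (V : Type) (e : V -> MD) (t : term Lg V) :
  D [set i | urep (eval e t) i = eval (fun v => urep (e v) i) t].
Proof.
elim: t => [v|s ts IH] /=; first exact: filterE.
have {}IH : D [set i | forall k, urep (eval e (ts k)) i = eval (fun v => urep (e v) i) (ts k)].
  exact: filter_forall.
have uE := urep_ucls (@ultra_proper _ _ UD) (fun i => fint (fun k => urep (eval e (ts k)) i)).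
apply: filterS2 IH uE => i /= IHi ->.
by congr (fint _); apply/funext.
Qed.

Lemma ultra_setC (A : set L) : ~ D A <-> D (~` A).
Proof.
split=> [nA|DnA DA]; first by case: (in_ultra_setVsetC A UD).
have : D set0 by rewrite -(setICr A); exact: filterI.
exact: filter_not_empty.
Qed.

Lemma los (V : Type) (e : V -> MD) (p : formula Lg V) :
  sat e p <-> D [set i | sat (fun v => urep (e v) i) p].
Proof.
elim: p e => [{}V t u|{}V s ts||{}V p IHp q IHq|{}V p IHp] e /=.
- rewrite urep_eqP; split; apply: filterS3 (ultrapower_eval e t) (ultrapower_eval e u).
    by move=> i /= -> ->.
  by move=> i /= -> ->.
- have Dts : D [set i | forall k, urep (eval e (ts k)) i = eval (fun v => urep (e v) i) (ts k)].
    by apply: filter_forall => k; exact: ultrapower_eval.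
  have tsE i : (forall k, urep (eval e (ts k)) i = eval (fun v => urep (e v) i) (ts k)) ->
      (fun k => urep (eval e (ts k)) i) = (fun k => eval (fun v => urep (e v) i) (ts k)).
    by move=> h; apply/funext.
  by split; apply: filterS2 Dts => i /tsE /= ->.
- by split=> // /filter_not_empty.
- rewrite IHp IHq; split=> [pq|]; last by move=> Dpq Dp; apply: filterS2 Dpq Dp => i /=; apply.
  have [Dp|/ultra_setC nDp] := pselect (D [set i | sat (fun v => urep (e v) i) p]).
    by apply: filterS (pq Dp) => i /= qi _.
  by apply: filterS nDp => i /= npi pi; case: (npi pi).
- split=> [allp|Dp a].
    apply: contrapT => /ultra_setC nD.
    (* One coordinate's counterexample serves as default value where there is none. *)
    have [i0 /existsNP[m0 _]] := filter_ex nD.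
    pose ext i (a : M) v := if v is Some w then urep (e w) i else a.
    have /choice[a aP] i : exists a, ~ (forall a, sat (ext i a) p) -> ~ sat (ext i a) p.
      have [all|/existsNP[a na]] := pselect (forall a, sat (ext i a) p).
        by exists m0.
      by exists a.
    have /IHp Dp := allp (ucls ultra_proper a).
    have : D set0; last exact: filter_not_empty.
    apply: filterS3 nD Dp (urep_ucls (@ultra_proper _ _ UD) a) => i /aP nsat + uE.
    apply: contra_not nsat.
    by congr sat; apply/funext => -[].
  apply/IHp; apply: filterS Dp => i /(_ (urep a i)).
  by congr sat; apply/funext => -[].
Qed.

End Los.

Section Realization.
Variables (L : choiceType) (D : set_system L).
Context {UD : UltraFilter D}.
Local Notation FD := (@ultra_proper _ _ UD).

Lemma los2 (Lg : language) (M : structure Lg) (n m : nat) (phi : formula2 Lg n m)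
    (x : 'I_n -> ultrapower FD M) (b : 'I_m -> ultrapower FD M) :
  sat2 phi x b <-> D [set i | sat2 phi (fun k => urep (x k) i) (fun k => urep (b k) i)].
Proof.
have eE i : (fun v => urep (match v with inl i => x i | inr j => b j end) i) =
    (fun v => match v with inl k => urep (x k) i | inr k => urep (b k) i end).
  by apply/funext => -[].
rewrite /sat2 los; split; apply: filterS => i /=; first by rewrite eE.
by rewrite -eE.
Qed.

(** An injection of [p] into [L] indexes the conditions; indices outside its image impose
    nothing. *)
Lemma saturated_realized (Lg : language) (M : structure Lg) (n m : nat)
    (phi : formula2 Lg n m) (p : set (pformula (ultrapower FD M) n)) B :
  infinite_set [set: L] -> saturated D [set: L] -> p #<= [set: L] ->
  p = [set PFormula phi b | b in B] -> consistent p -> realized p.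
Proof.
move=> /infinite_setN0[a0 _] satD /(card_le_injP a0)[idx _ idx_inj] pE pcons.
(* Consistency of the empty type supplies the default point. *)
have [y _] : realized (set0 : set (pformula (ultrapower FD M) n)).
  by apply: pcons => //; exact: finite_set0.
have [B0|/set0P[b0 Bb0]] := eqVneq B set0.
  by exists y => psi; rewrite pE B0 image_set0.
have pB b : B b -> p (PFormula phi b) by rewrite pE => Bb; exists b.
pose active l := exists2 b, B b & idx (PFormula phi b) = l.
have /choice[c cP] l : exists b, active l -> B b /\ idx (PFormula phi b) = l.
  have [[b Bb bl]|nl] := pselect (active l); first by exists b.
  by exists b0.
have [F _|x xP] := satD (fun _ => 'I_n -> M) (fun i k => urep (y k) i)
    (fun l i x => active l -> sat2 phi x (fun k => urep (c l k) i)).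
  have [||x xF] := pcons [set PFormula phi (c l) | l in [set l | l \in F /\ active l]].
  - by move=> _ [l [_ /cP[Bl _]] <-]; exact: pB.
  - apply: finite_image; apply: (@sub_finite_set _ _ [set` F]); first by move=> l [].
    exact: finite_fset.
  have : D [set i | forall l, l \in F -> active l ->
      sat2 phi (fun k => urep (x k) i) (fun k => urep (c l k) i)].
    apply: filter_fset => l lF; have [al|nal] := pselect (active l).
      have /los2 : sat2 phi x (c l).
        by apply: (xF (PFormula phi (c l))); exists l.
      by apply: filterS.
    by apply: filterE.
  by apply: filterS => i xFi; exists (fun k => urep (x k) i).
exists (fun k => ucls FD (fun i => x i k)) => psi ppsi.
have [b Bb psiE] : [set PFormula phi b | b in B] psi by rewrite -pE.
have al : active (idx psi) by exists b; rewrite ?psiE.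
have [Bc cidx] := cP _ al.
have <- : PFormula phi (c (idx psi)) = psi by apply: idx_inj => //; apply/mem_set => //; exact: pB.
apply/los2; have xE : D [set i | forall k, urep (ucls FD (fun i => x i k)) i = x i k].
  by apply: filter_forall => k; exact: (urep_ucls FD (fun i => x i k)).
apply: filterS2 (xP (idx psi) I) xE => i /(_ al) /= + /funext xE.
by rewrite xE.
Qed.

End Realization.

(** * Graphs without induced [C4] and [l4] *)

Section PrefixEmbedding.
Variables (T : eqType) (c : rel T) (V : seq T).
Hypotheses (crefl : reflexive c) (csym : symmetric c).
Hypothesis cnested : forall x y, c x y ->
  (forall z, c x z -> c y z) \/ (forall z, c y z -> c x z).

Let nb x := count (c x) V.

(** Of two nested neighbourhoods the one with the larger count contains the other on [V]: a missing
    [z] would make the counts compare the wrong way. *)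
Let nb_nested x y z : c x y -> (nb y <= nb x)%N -> z \in V -> c y z -> c x z.
Proof.
move=> /cnested[xy|yx] nbyx zV cyz; last exact: yx.
apply: contraLR nbyx => ncxz; rewrite -ltnNge.
have UI := count_predUI (c x) (pred1 z) V.
have I0 : count (predI (c x) (pred1 z)) V = 0%N.
  rewrite (eq_count (a2 := pred0)) ?count_pred0 // => w /=.
  by apply/andP => -[cxw /eqP wz]; rewrite -wz cxw in ncxz.
have z0 : (0 < count (pred1 z) V)%N by rewrite -has_count has_pred1.
apply: (@leq_trans (count (predU (c x) (pred1 z)) V)).
  by move: UI; rewrite I0 addn0 => ->; rewrite -addn1 leq_add2l.
by apply: sub_count => w /= /orP[/xy//|/eqP ->].
Qed.

Let l := sort (fun x y => (nb y <= nb x)%N) V.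

Let l_sorted : {in l &, forall x y, (index x l <= index y l)%N -> (nb y <= nb x)%N}.
Proof.
apply: (sorted_leq_index (leT := fun x y => (nb y <= nb x)%N)).
- by move=> b a d ab bd; exact: leq_trans ab.
- by move=> x; exact: leqnn.
- by apply: sort_sorted => a b; exact: leq_total.
Qed.

(* The [k]-th bit of the word of [y] records whether the [k]-th vertex, in order of
   decreasing degree, is adjacent or equal to [y]. *)
Lemma prefix_embedding : exists eta : T -> seq bool, {in V &, forall x y,
  prefix (eta x) (eta y) || prefix (eta y) (eta x) = c x y}.
Proof.
pose eta y := map (c^~ y) (take (index y l).+1 l).
exists eta => x y xV yV.
have xl : x \in l by rewrite mem_sort.
have yl : y \in l by rewrite mem_sort.
have size_eta z : z \in l -> size (eta z) = (index z l).+1.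
  by move=> zl; rewrite size_map size_takel // index_mem.
have take_eta z w : (index z l <= index w l)%N ->
    take (index z l).+1 (eta w) = map (c^~ w) (take (index z l).+1 l).
  by move=> zw; rewrite -map_take take_takel.
have nth_eta z w : z \in l ->
    nth false (map (c^~ w) (take (index z l).+1 l)) (index z l) = c z w.
  move=> zl; rewrite (nth_map z) ?nth_take ?nth_index //.
  by rewrite size_takel // index_mem.
(* The last bit of [eta z] is [c z z], which is true; the same bit of [eta w] is [c z w]. *)
have prefix_c z w : z \in l -> w \in l -> prefix (eta z) (eta w) -> c z w.
  move=> zl wl zw; have := size_prefix zw; rewrite !size_eta // ltnS => zw_idx.
  move: zw; rewrite prefixE size_eta // take_eta // => /eqP.
  move=> /(congr1 (fun s => nth false s (index z l))).
  by rewrite !nth_eta // crefl.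
have c_prefix z w : z \in l -> w \in l -> (index z l <= index w l)%N -> c z w ->
    prefix (eta z) (eta w).
  move=> zl wl zw czw; rewrite prefixE size_eta // take_eta //; apply/eqP.
  (* Neighbourhoods grow with degree along edges, so a vertex [u] sorted before [z] cannot tell [z]
     from [w]. *)
  apply/eq_in_map => u uz; have ul := mem_take uz.
  have uz_idx : (index u l <= index z l)%N by rewrite -ltnS -in_take.
  have lV a : a \in l -> a \in V by rewrite mem_sort.
  have nbz := l_sorted ul zl uz_idx.
  have nbw := l_sorted zl wl zw.
  apply/idP/idP => [cuw|cuz].
    by rewrite csym; apply: (nb_nested czw nbw (lV u ul)); rewrite csym.
  by apply: (nb_nested cuz nbz (lV w wl)).
apply/idP/idP => [/orP[|]|cxy].
- exact: prefix_c.
- by rewrite csym; exact: prefix_c.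
- have [xy|/ltnW yx] := leqP (index x l) (index y l); first by rewrite c_prefix.
  by rewrite (c_prefix y x) ?orbT // csym.
Qed.

End PrefixEmbedding.

Definition closed_adj (G : graph) (x y : G) : Prop := x = y \/ adj x y.

(** A neighbour [a] of [x] only and a neighbour [b] of [y] only would form an induced [C4] or [l4]
    with [x] and [y], according to whether [a] and [b] are adjacent. *)
Lemma closed_adj_nested (G : graph) (x y : G) :
  ~ induced_subgraph C4 G -> ~ induced_subgraph l4 G -> closed_adj x y ->
  (forall z, closed_adj x z -> closed_adj y z) \/ (forall z, closed_adj y z -> closed_adj x z).
Proof.
move=> noC4 nol4 cxy; apply: contrapT => /not_orP[/existsNP[a /not_implyP[xa nya]]].
move=> /existsNP[b /not_implyP[yb nxb]].
have xy : adj x y by case: cxy => // xy; case: nya; rewrite -xy.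
have yx := adj_sym xy.
have xa' : adj x a by case: xa => // xa; case: nya; rewrite -xa; right.
have yb' : adj y b by case: yb => // yb; case: nxb; rewrite -yb; right.
have ax' := adj_sym xa'; have by' := adj_sym yb'.
have nya' : ~ adj y a by move=> ya; apply: nya; right.
have nay' : ~ adj a y by move=> /adj_sym.
have nxb' : ~ adj x b by move=> xb; apply: nxb; right.
have nbx' : ~ adj b x by move=> /adj_sym.
have ax : a <> x by move=> ax; apply: nya; right; rewrite ax.
have ay : a <> y by move=> ay; apply: nya; left.
have ab : a <> b by move=> ab; apply: nxb; rewrite -ab; right.
have xb1 : x <> b by move=> xb1; apply: nxb; left.
pose h (i : 'I_4) : G := nth a [:: a; x; y; b] i.
have hinj : injective h.
  by move=> [[|[|[|[|i]]]] // Hi] [[|[|[|[|j]]]] // Hj]; rewrite /h /= => e;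
    try (by apply/val_inj); exfalso; (congruence || (apply esym in e; congruence)).
have irr u := adj_irrefl (g := G) (x := u).
have [abj|nab] := pselect (adj a b).
  have ba := adj_sym abj.
  apply: noC4; exists h; split => //.
    move=> [[|[|[|[|i]]]] // Hi] [[|[|[|[|j]]]] // Hj] [] /(congr1 val) //=.
  move=> [[|[|[|[|i]]]] // Hi] [[|[|[|[|j]]]] // Hj] nij; rewrite /h //=;
    by case: nij; (left + right); apply/val_inj.
have nba : ~ adj b a by move=> /adj_sym.
apply: nol4; exists h; split => //.
  by move=> [[|[|[|[|i]]]] // Hi] [[|[|[|[|j]]]] // Hj] [].
move=> [[|[|[|[|i]]]] // Hi] [[|[|[|[|j]]]] // Hj] nij; rewrite /h //=;
  by case: nij; (left + right).
Qed.

(** * Complete sets in ultraproducts of graphs *)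

Lemma prefix_cmp (T : eqType) (s t x : seq T) :
  prefix s x -> prefix t x -> prefix s t \/ prefix t s.
Proof.
rewrite !prefixE => /eqP sx /eqP tx.
have [st|/ltnW ts] := leqP (size s) (size t); [left|right]; apply/eqP.
  by rewrite -tx take_takel.
by rewrite -sx take_takel.
Qed.

Lemma seq_prefix_max (I : eqType) (s : seq I) (w : I -> seq bool) :
  (forall a b, a \in s -> b \in s -> prefix (w a) (w b) \/ prefix (w b) (w a)) ->
  exists x, forall a, a \in s -> prefix (w a) x.
Proof.
case: s => [|a s] cmp; first by exists [::].
have [|||c _ cmax] := @seq_max I (fun a b => prefix (w a) (w b)) (a :: s) a.
- by move=> x y z; exact: prefix_trans.
- exact: cmp.
- exact: mem_head.
by exists (w c) => b /cmax.
Qed.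

(** * The binary tree as a structure *)

Definition prefix_language : language :=
  @Language void (fun f => match f with end) unit (fun _ => 2).

Definition prefix_structure : structure prefix_language :=
  @Structure prefix_language (seq bool) (fun f => match f with end)
    (fun _ x => prefix (x ord0) (x ord_max)).

(* The formula [y <= x] in the variable [x] and the parameter [y]. *)
Definition prefix_formula : formula2 prefix_language 1 1 :=
  @Rel prefix_language ('I_1 + 'I_1) tt
    (fun k : 'I_2 => Var _ (if k == ord0 then inr ord0 else inl ord0)).

Lemma sat2_prefix (x a : 'I_1 -> prefix_structure) :
  sat2 prefix_formula x a <-> prefix (a ord0) (x ord0).
Proof. by []. Qed.

(** Words with a common extension are comparable, and a finite chain is bounded by its longest
    word. *)
Lemma prefix_SOP2_tree :
  @SOP2_tree prefix_language prefix_structure 1 1 prefix_formula (fun s _ => s).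
Proof.
pose pf (s : prefix_structure) : pformula prefix_structure 1 :=
  PFormula prefix_formula (fun _ => s).
move=> G; split=> [Gcons s t Gs Gt|Gchain q qG qfin].
  have [||x xq] := Gcons [set pf u | u in [set s; t]].
  - by move=> _ [u + <-] => -[->|->]; [exists s|exists t].
  - by apply: finite_image; exact: finite_set2.
  have /sat2_prefix/= sx := xq (pf s) (imageP _ (or_introl erefl)).
  have /sat2_prefix/= tx := xq (pf t) (imageP _ (or_intror erefl)).
  exact: prefix_cmp sx tx.
have /choice[w wP] psi : exists s, q psi -> G s /\ pf s = psi.
  have [/qG[s Gs <-]|nq] := pselect (q psi); first by exists s.
  by exists [::].
have /finite_fsetP[F FE] := finite_image w qfin.
have FG s : s \in F -> G s.
  by move=> sF; have [psi /wP[Gw _] <-] : (w @` q) s by rewrite FE.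
have [|x xF] := @seq_prefix_max _ F id.
  by move=> s t /FG Gs /FG Gt; exact: Gchain.
exists (fun _ => x) => psi qpsi; have [_ <-] := wP _ qpsi.
apply/sat2_prefix; apply: xF; have : [set` F] (w psi) by rewrite -FE; exists psi.
by [].
Qed.

Section CompleteSets.
Variables (L : choiceType) (D : set_system L).
Context {UD : UltraFilter D}.
Local Notation FD := (@ultra_proper _ _ UD).

Lemma internal_complete (G : L -> graph) (H : set (graph_ultraproduct FD G)) :
  infinite_set [set: L] -> regular D ->
  (forall (Lg : language) (M : structure Lg) (n m : nat)
     (phi : formula2 Lg n m) (A : set ('I_m -> M)), witnesses_SOP2 phi A ->
     forall p : set (pformula (ultrapower FD M) n),
       A_type phi A p -> p #<= [set: L] -> realized p) ->
  (forall i, ~ induced_subgraph C4 (G i) /\ ~ induced_subgraph l4 (G i)) ->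
  complete H -> H #= [set: L] ->
  exists K : set (graph_ultraproduct FD G), [/\ internal K, complete K & H `<=` K].
Proof.
move=> Linf /regular_family[E [DE Efin]] SOP2_realized noG Hcomplete HL.
have [a0 _] := infinite_setN0 Linf.
move: HL; rewrite card_eq_le => /andP[/(card_le_injP a0)[idx _ idx_inj] LH].
have [v0 Hv0] : H !=set0.
  by apply: infinite_setN0 => Hfin; apply: Linf; exact: card_le_finite LH Hfin.
have /choice[h hP] a : exists v, H v /\ forall w, H w -> idx w = a -> v = w.
  have [[v [Hv <-]]|nv] := pselect (exists v, H v /\ idx v = a).
    by exists v; split=> // w Hw wv; apply: idx_inj; rewrite ?inE.
  by exists v0; split=> // w Hw wa; case: nv; exists w.
have Hh a : H (h a) by case: (hP a).
pose c i (u v : {classic G i}) := `[< closed_adj (u : G i) v >].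
have hc a b : D [set i | c i (urep (h a) i) (urep (h b) i)].
  have [->|nab] := pselect (h a = h b).
    by apply: filterE => i; apply/asboolP; left.
  have := Hcomplete _ _ (Hh a) (Hh b) nab; apply: filterS => i adjab.
  by apply/asboolP; right.
have /dependent_choice[eta etaP] i : exists eta : G i -> seq bool, forall a b, E a i -> E b i ->
    prefix (eta (urep (h a) i)) (eta (urep (h b) i)) \/
    prefix (eta (urep (h b) i)) (eta (urep (h a) i)) <-> c i (urep (h a) i) (urep (h b) i).
  have [F FE] : exists F : {fset L}, [set a | E a i] = [set` F] by exact/finite_fsetP.
  have [||u v uv|eta etaP] := @prefix_embedding {classic G i} (c i)
      [seq (urep (h a) i : {classic G i}) | a <- F].
  - by move=> u; apply/asboolP; left.
  - by move=> u v; apply/asboolP/asboolP => -[->|/adj_sym]; [left|right|left|right].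
  - have [nC4 nl4] := noG i.
    have /(closed_adj_nested nC4 nl4)[uv'|vu'] : closed_adj (u : G i) v by apply/asboolP.
      by left=> w /asboolP/uv'/asboolP.
    by right=> w /asboolP/vu'/asboolP.
  have EF a : E a i -> a \in F by move=> Ea; have : [set a | E a i] a by []; rewrite FE.
  exists eta => a b /EF aF /EF bF; rewrite -etaP ?map_f //.
  by split=> /orP.
pose b_ a : 'I_1 -> ultrapower FD prefix_structure :=
  fun _ => ucls FD (fun i => eta i (urep (h a) i) : prefix_structure).
pose p := [set PFormula prefix_formula (b_ a) | a in [set: L]].
have b_E a : D [set i | urep (b_ a ord0) i = eta i (urep (h a) i)].
  exact: (urep_ucls FD (fun i => eta i (urep (h a) i) : prefix_structure)).
have [x xp] : realized p.
  apply: (SOP2_realized _ prefix_structure 1 1 prefix_formula (range (fun s _ => s))).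
  - by exists (fun s _ => s); split => //; exact: prefix_SOP2_tree.
  - split; last first.
      exists (range b_); split; first by rewrite image_comp.
      move=> _ [a _ <-]; exists (fun i _ => eta i (urep (h a) i)); split => //.
    move=> q qp qfin.
    have /choice[w wP] psi : exists a, q psi -> PFormula prefix_formula (b_ a) = psi.
      have [/qp[a _ <-]|nq] := pselect (q psi); first by exists a.
      by exists a0.
    have /finite_fsetP[F FE] := finite_image w qfin.
    have [|x xF] := @filter_choice L D UD (fun _ => seq bool) (fun _ => [::])
        (fun i x => forall a, a \in F -> prefix (eta i (urep (h a) i)) x).
      have : D [set i | forall a, a \in F -> forall b, b \in F ->
          prefix (eta i (urep (h a) i)) (eta i (urep (h b) i)) \/
          prefix (eta i (urep (h b) i)) (eta i (urep (h a) i))].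
        apply: filter_fset => a _; apply: filter_fset => b _.
        by apply: filterS3 (hc a b) (DE a) (DE b) => i hcab Ea Eb; apply/etaP.
      apply: filterS => i Fi; apply: (@seq_prefix_max L F (fun a => eta i (urep (h a) i))).
      by move=> a b aF bF; exact: Fi.
    exists (fun _ => ucls FD (fun i => x i : prefix_structure)) => psi qpsi.
    rewrite -(wP psi qpsi) /=; apply/los2.
    have wF : w psi \in F by have : [set` F] (w psi); [rewrite -FE; exists psi|].
    have xE := urep_ucls FD (fun i => x i : prefix_structure).
    apply: filterS3 xF (b_E (w psi)) xE => i xFi bE xE; apply/sat2_prefix.
    by rewrite bE xE; exact: xFi.
  - exact: card_image_le.
pose base i : set (G i) := [set v | exists a, [/\ E a i, urep (h a) i = v
  & prefix (eta i v) (urep (x ord0) i)]].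
(* The extra vertex keeps [Kf i] nonempty, so that a representative can be corrected at the
   coordinates where it leaves [Kf i]. *)
pose Kf i : set (G i) := [set v | base i v \/ (base i = set0 /\ v = urep (h a0) i)].
have Kf0 i : exists v, Kf i v.
  have [b0|/set0P[v bv]] := eqVneq (base i) set0; last by exists v; left.
  by exists (urep (h a0) i); right.
have Kf_adj i u v : Kf i u -> Kf i v -> u <> v -> adj u v.
  move=> [bu|[bi0 ->]] [bv|[bi0' ->]] uv //.
  - case: bu bv => [a [Ea aE ua]] [b [Eb bE vb]]; subst u v.
    have : c i (urep (h a) i) (urep (h b) i).
      apply/etaP => //; exact: prefix_cmp ua vb.
    by move=> /asboolP[].
  - by rewrite bi0' in bu.
  - by rewrite bi0 in bv.
exists [set ucls FD r | r in [set r | forall i, Kf i (r i)]]; split.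
- by exists Kf.
- move=> _ _ [r rK <-] [s sK <-] nrs.
  have nrsD : D (~` [set i | r i = s i]) by apply/ultra_setC => /(ucls_eqP FD r s).
  apply: filterS3 nrsD (urep_ucls FD r) (urep_ucls FD s) => i /= rs -> ->.
  exact: Kf_adj.
- move=> v Hv; have [_ /(_ v Hv erefl) hv] := hP (idx v).
  have /dependent_choice[k kP] i := Kf0 i.
  pose r i : G i := if pselect (Kf i (urep v i)) then urep v i else k i.
  exists r; first by move=> i; rewrite /r; case: pselect.
  rewrite -[RHS]urepK; apply/ucls_eqP.
  have /los2 := xp (PFormula prefix_formula (b_ (idx v))) (imageP _ I).
  apply: filterS3 (b_E (idx v)) (DE (idx v)) => i bE Ev /sat2_prefix; rewrite bE hv => pre.
  rewrite /= /r; case: pselect => // nK; case: nK; left; exists (idx v).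
  by rewrite hv.
Qed.

Lemma refinement_of_internal_complete (f : {fset L} -> set L) :
  infinite_set [set: L] ->
  (forall G : L -> graph,
     (forall i, ~ induced_subgraph C4 (G i) /\ ~ induced_subgraph l4 (G i)) ->
     forall H : set (graph_ultraproduct FD G), complete H -> H #= [set: L] ->
     exists K : set (graph_ultraproduct FD G), [/\ internal K, complete K & H `<=` K]) ->
  into D f -> graph_like f ->
  (forall x0 x1 x2 x3 : L, uniq [:: x0; x1; x2; x3] ->
     f [fset x0; x1]%fset `&` f [fset x1; x2]%fset `&` f [fset x2; x3]%fset
       `<=` f [fset x0; x2]%fset `|` f [fset x1; x3]%fset) ->
  has_multiplicative_refinement D f.
Proof.
move=> /infinite_setN0[a0 _] internal_cover fD fgraph f4.
pose R i a b := a <> b /\ f [fset a; b]%fset i.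
have Rsym i a b : R i a b -> R i b a by move=> [ab fab]; split; [exact: nesym|rewrite fsetUC].
have Rirr i a : ~ R i a a by case.
pose G i : graph := Graph (Rsym i) (Rirr i).
(* [C4] and [l4] both contain the path 0, 1, 2, 3 and lack the edges 02 and 13, so this excludes
   both. *)
have path4 i (h : 'I_4 -> G i) : injective h ->
    adj (h (inord 0)) (h (inord 1)) -> adj (h (inord 1)) (h (inord 2)) ->
    adj (h (inord 2)) (h (inord 3)) ->
    adj (h (inord 0)) (h (inord 2)) \/ adj (h (inord 1)) (h (inord 3)).
  move=> hinj [n01 f01] [n12 f12] [n23 f23].
  have hne j k : (j < 4)%N -> (k < 4)%N -> j != k -> h (inord j) <> h (inord k).
    by move=> j4 k4 jk /hinj/(congr1 val); rewrite /= !inordK // => /eqP; rewrite (negbTE jk).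
  have := f4 (h (inord 0)) (h (inord 1)) (h (inord 2)) (h (inord 3)).
  have hneb j k : (j < 4)%N -> (k < 4)%N -> j != k -> h (inord j) != h (inord k) :> L.
    by move=> j4 k4 jk; apply/eqP; exact: hne.
  rewrite /= !inE !negb_or !hneb //= => /(_ isT i) [//|f02|f13]; [left|right];
    split => //; exact: hne.
pose h a : graph_ultraproduct FD G := ucls FD (fun i => a : G i).
have hE a : D [set i | urep (h a) i = a] by exact: (urep_ucls FD (fun i => a : G i)).
have hinj : injective h.
  move=> a b /(ucls_eqP FD (fun i => a : G i) (fun i => b : G i)) Dab.
  by have [] := filter_ex Dab.
have [i|||K [[Kf KE] Kcomplete HK]] := internal_cover G _ (range h).
- split=> -[k [kinj kadj knadj]].
    have n02 : ~ C4_adj (inord 0) (inord 2) by case=> /(congr1 val); rewrite /= !inordK.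
    have n13 : ~ C4_adj (inord 1) (inord 3) by case=> /(congr1 val); rewrite /= !inordK.
    have [] : adj (k (inord 0)) (k (inord 2)) \/ adj (k (inord 1)) (k (inord 3)).
      by apply: path4 => //; apply: kadj; left; apply/val_inj; rewrite /= !inordK.
    + exact: knadj n02.
    + exact: knadj n13.
  have n02 : ~ l4_adj (inord 0) (inord 2) by case; rewrite !inordK.
  have n13 : ~ l4_adj (inord 1) (inord 3) by case; rewrite !inordK.
  have [] : adj (k (inord 0)) (k (inord 2)) \/ adj (k (inord 1)) (k (inord 3)).
    by apply: path4 => //; apply: kadj; left; rewrite !inordK.
  + exact: knadj n02.
  + exact: knadj n13.
- move=> _ _ [a _ <-] [b _ <-] nab; apply: filterS3 (hE a) (hE b) (fD [fset a; b]%fset).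
  by move=> i /= -> -> fab; split => // ab; apply: nab; rewrite ab.
- by apply: inj_card_eq => a b _ _; exact: hinj.
have hK a : D [set i | Kf i a].
  have [r rK rh] : [set ucls FD r | r in [set r | forall i, Kf i (r i)]] (h a).
    by rewrite -KE; apply: HK; exists a.
  have : D [set i | r i = a] by apply/(ucls_eqP FD r (fun i => a : G i)).
  by apply: filterS => i <-.
have [r0 r0K _] : [set ucls FD r | r in [set r | forall i, Kf i (r i)]] (h a0).
  by rewrite -KE; apply: HK; exists a0.
(* Otherwise non-adjacent pairs chosen at the bad coordinates give two distinct non-adjacent classes
   in [K]; [r0] fills the good coordinates. *)
have Kclique : D [set i | forall a b, Kf i a -> Kf i b -> a <> b -> f [fset a; b]%fset i].
  apply: contrapT => /(@ultra_setC L D UD) bad.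
  have /dependent_choice[uv uvP] i : exists uv : G i * G i, [/\ Kf i uv.1, Kf i uv.2 &
      ~ (forall a b, Kf i a -> Kf i b -> a <> b -> f [fset a; b]%fset i) ->
      uv.1 <> uv.2 /\ ~ f [fset uv.1; uv.2]%fset i].
    have [clique|] := pselect (forall a b, Kf i a -> Kf i b -> a <> b -> f [fset a; b]%fset i).
      by exists (r0 i, r0 i); split => //=; exact: r0K.
    move=> /existsNP[a /existsNP[b /not_implyP[Ka /not_implyP[Kb /not_implyP[ab nf]]]]].
    by exists (a, b); split.
  pose r i := (uv i).1; pose s i := (uv i).2.
  have Kr : K (ucls FD r) by rewrite KE; exists r => // i; case: (uvP i).
  have Ks : K (ucls FD s) by rewrite KE; exists s => // i; case: (uvP i).
  have rs : ucls FD r <> ucls FD s.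
    move=> /(ucls_eqP FD r s) Drs; have [i [badi]] := filter_ex (filterI bad Drs).
    by have [_ _ /(_ badi)[]] := uvP i.
  have adj_rs := Kcomplete _ _ Kr Ks rs.
  have : D set0; last exact: filter_not_empty.
  apply: filterS2 bad (filterI adj_rs (filterI (urep_ucls FD r) (urep_ucls FD s))).
  move=> i badi [+ [/= rE sE]]; rewrite /= rE sE => -[_ frs].
  by have [_ _ /(_ badi)[_]] := uvP i; apply.
pose clique i := forall a b, Kf i a -> Kf i b -> a <> b -> f [fset a; b]%fset i.
(* The cuts by [f] on the empty set and on singletons handle the sizes that graph-likeness does not
   reach. *)
exists (fun d => [set i | [/\ clique i, f fset0 i
  & forall a, a \in d -> Kf i a /\ f [fset a]%fset i]]).
split=> [d|d i [cl f0 fd]|d e].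
- have Dd : D [set i | forall a, a \in d -> Kf i a /\ f [fset a]%fset i].
    by apply: filter_fset => a _; apply: filterI; [exact: hK|exact: fD].
  by apply: filterS3 Kclique (fD fset0) Dd.
- have [d2|] := leqP 2 #|` d|.
    rewrite (fgraph d d2) => p [/fsubsetP pd p2].
    have [a ap] : exists a, a \in p by apply/fset0Pn; rewrite -cardfs_gt0 p2.
    have : #|` (p `\ a)%fset| == 1%N by have := cardfsD1 a p; rewrite ap p2 add1n => -[<-].
    move=> /cardfs1P[b pb]; have pE : p = [fset a; b]%fset by rewrite -(fsetD1K ap) pb.
    have /andP[ba bp] : (b != a) && (b \in p) by rewrite -in_fsetD1 pb inE.
    rewrite pE; apply: cl; [by case: (fd a (pd a ap))|by case: (fd b (pd b bp))|].
    by move=> ab; rewrite ab eqxx in ba.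
  rewrite ltnS leq_eqVlt ltnS leqn0 => /orP[/cardfs1P[a dE]|]; last first.
    by rewrite cardfs_eq0 => /eqP ->.
  by rewrite dE; case: (fd a) => //; rewrite dE inE.
- apply/seteqP; split=> i.
    by move=> [cl f0 fd]; split; split => // a ad; apply: fd; rewrite inE ad ?orbT.
  by move=> [[cl f0 fd] [_ _ fe]]; split => // a; rewrite inE => /orP[/fd|/fe].
Qed.

End CompleteSets.

(** * Closing the cycle of implications *)

Unset Implicit Arguments.

Theorem theorem8p4 (L : choiceType) (D : set_system L) (UD : UltraFilter D)
    (Linf : infinite_set [set: L]) (Dreg : regular D) :
  [<-> good D;
       forall (Lg : language) (M : structure Lg) (n m : nat)
         (phi : formula2 Lg n m) (A : set ('I_m -> M)),
         witnesses_SOP2 phi A ->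
         forall p : set (pformula (ultrapower ultra_proper M) n),
           A_type phi A p -> p #<= [set: L] -> realized p;
       forall G : L -> graph,
         (forall i, ~ induced_subgraph C4 (G i) /\
                    ~ induced_subgraph l4 (G i)) ->
         forall H : set (graph_ultraproduct ultra_proper G),
           complete H -> H #= [set: L] ->
           exists K : set (graph_ultraproduct ultra_proper G),
             [/\ internal K, complete K & H `<=` K];
       forall f : {fset L} -> set L,
         into D f -> graph_like f ->
         (forall x0 x1 x2 x3 : L, uniq [:: x0; x1; x2; x3] ->
            f [fset x0; x1] `&` f [fset x1; x2] `&` f [fset x2; x3]
              `<=` f [fset x0; x2] `|` f [fset x1; x3]) ->
         has_multiplicative_refinement D f].
Proof.
tfae.
- move=> goodD Lg M n m phi A _ p [pcons [B [pE _]]] pL.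
  exact: saturated_realized (good_saturated Dreg goodD) pL pE pcons.
- by move=> SOP2_realized G noG H; exact: internal_complete.
- by move=> internal_cover f; exact: refinement_of_internal_complete.
- move=> refinements; apply: (saturated_good Linf).
  have [lt wo] := exists_well_order_lt L.
  exact: saturatedT wo (treetops_of_refinements Dreg refinements).
Qed.
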